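(* Let $\Sigma$ be a topologically mixing topological Markov chain over a countably infinite alphabet $\mathcal I$ satisfying the BIP property. Let $\phi:\Sigma\to\mathbb R$ satisfy $\sum_{n\ge1}V_n(\phi)<\infty$ and $\sup\phi<\infty$, and let $\widehat\mu$ be an atomless $\sigma$-Gibbs measure with potential $\phi$. Let $w\in\Sigma$, let $\widehat P$ be an $N$-cylinder for some $N$, and let $\{\ell_n\}\subset\mathbb N$ be such that the limit $s:=\lim_{n\to\infty}-\frac1n\log\widehat\mu(C(\ell_n,w))$ exists and is finite. If there exists $0<t_1\le1$ such that $$\infty>P_G(t_1\phi)-P_G(\phi)t_1>st_1\qquad\text{and}\qquad -\sum_{i\in\mathcal I}\widehat\mu(C_i)^{t_1}\log\widehat\mu(C_i)<\infty,$$ then $$\mathrm{Dim}_{\widehat\mu}(W_\sigma(\widehat P,\ell_n,w))=\sup\{t\ge t_1: P_G(t\phi)-P_G(\phi)t>st\}=\inf\{t>0: P_G(t\phi)-P_G(\phi)t<st\}.$$ If moreover $\phi$ is weakly Hölder continuous, then $\mathrm{Dim}_{\widehat\mu}(W_\sigma(\widehat P,\ell_n,w))=T$ with $P_G(T\phi)-P_G(\phi)T=sT$.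
   Context: Markov chain: $A=(a_{i,j})$ is an $\mathcal I\times\mathcal I$ matrix with entries in $\{0,1\}$, $\Sigma=\{(i_0,i_1,\dots): i_k\in\mathcal I,\ a_{i_k,i_{k+1}}=1\ \forall k\ge 0\}$, with metric $d((i_k),(j_k))=2^{-m}$, $m=\min\{n: i_n\ne j_n\}$, and left shift $\sigma$. An $n$-cylinder is a nonempty set $C_{i_0\dots i_n}=\{k\in\Sigma: k_r=i_r,\ 0\le r\le n\}$; $C(n,w):=C_{w_0\dots w_n}$. Topologically mixing: for all $a,b\in\mathcal I$ there is $N(a,b)$ such that for all $n\ge N(a,b)$ some $w\in\Sigma$ has $w_0=a$, $w_n=b$. BIP property: there is a finite $\mathcal I_0\subset\mathcal I$ such that for each $i\in\mathcal I$ there are $k,\ell\in\mathcal I_0$ with $C_{ki\ell}\neq\varnothing$. Variations: $V_n(\phi)=\sup\{|\phi(w)-\phi(w')|: w_k=w'_k,\ 0\le k\le n-1\}$. Weakly Hölder continuous: there are $B>0$, $\theta\in(0,1)$ with $V_n(\phi)\le B\theta^n$ for all $n\ge2$. Gibbs: a Borel probability $\widehat\mu$ is a Gibbs measure for $\phi$ if there are constants $P$ and $c\ge1$ with $c^{-1}\le \widehat\mu(C_{i_0\dots i_{n-1}})/\exp(-nP+\sum_{j=0}^{n-1}\phi(\sigma^jz))\le c$ for all $n\ge1$, all cylinders and all $z\in C_{i_0\dots i_{n-1}}$; $\sigma$-Gibbs means in addition $\sigma$-invariant. Gurevich pressure: $P_G(\phi)=\lim_n\frac1n\log\sum_{w\in\Sigma,\,w_0=i,\,\sigma^n(w)=w}\exp\sum_{j=0}^{n-1}\phi(\sigma^jw)$,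 independent of $i\in\mathcal I$. Target set: $W_\sigma(\widehat P,\ell_n,w)=\{z\in\widehat P:\ \sigma^k(z)\in C(\ell_k,w)\text{ for infinitely many }k\}$. Dimension: for $E\subset\Sigma$, $\alpha\ge0$, $M_\alpha(E)=\lim_{\varepsilon\to0}\inf\{\sum_i\widehat\mu(F_i)^\alpha: E\subset\bigcup_iF_i,\ F_i\text{ cylinders},\ \mathrm{diam}\,F_i\le\varepsilon\}$, and $\mathrm{Dim}_{\widehat\mu}(E)=\inf\{\alpha: M_\alpha(E)=0\}$. *)

(* Defs.v *)
From HB Require Import structures.
From mathcomp Require Import all_boot all_order all_algebra.
From mathcomp Require Import all_classical all_reals all_analysis.

Set Implicit Arguments.
Unset Strict Implicit.
Unset Printing Implicit Defensive.

Import Order.TTheory GRing.Theory Num.Theory.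
Import numFieldNormedType.Exports.

Local Open Scope classical_set_scope.
Local Open Scope ring_scope.

(* A 0/1 transition matrix over the alphabet I.  The non-emptiness field is
   there because a measurableType must be inhabited; it is implied by
   topological mixing as soon as I is inhabited. *)
Record markov_matrix (I : Type) := MarkovMatrix {
  transition :> I -> I -> bool ;
  admissible_ex : exists x : nat -> I, forall k, transition (x k) (x k.+1) }.

(* The parameter R is the field in which the metric takes its values; it plays
   no role in the points of the space. *)
Record shift_space (R : realType) (I : countType) (A : markov_matrix I) :=
  ShiftSpace {
    coordinate :> nat -> I ;
    coordinateP : forall k, A (coordinate k) (coordinate k.+1) }.

Section shift_metric.
Context (R : realType) (I : countType) (A : markov_matrix I).
Local Notation Sigma := (shift_space R A).

HB.instance Definition _ := gen_eqMixin Sigma.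
HB.instance Definition _ := gen_choiceMixin Sigma.
HB.instance Definition _ := isPointed.Build Sigma
  (ShiftSpace R (projT2 (cid (admissible_ex A)))).

Lemma shift_space_ext (x y : Sigma) : (forall n, x n = y n) -> x = y.
Proof.
case: x y => [x px] [y py] /= xy; have {}xy : x = y by exact/funext.
by subst y; rewrite (Prop_irrelevance px py).
Qed.

Definition shift_dist (x y : Sigma) : R :=
  match pselect (exists n, x n != y n) with
  | left xy => 2^-1 ^+ ex_minn xy
  | right _ => 0
  end.

Lemma shift_dist_ge0 x y : 0 <= shift_dist x y.
Proof. by rewrite /shift_dist; case: pselect. Qed.

Lemma shift_distxx x : shift_dist x x = 0.
Proof. by rewrite /shift_dist; case: pselect => // xx; exfalso; case: xx => n; rewrite eqxx. Qed.

Lemma shift_dist_positivity x y : shift_dist x y = 0 -> x = y.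
Proof.
rewrite /shift_dist; case: pselect => [xy /eqP|xy _].
  by rewrite expf_eq0 invr_eq0 pnatr_eq0 andbF.
apply: shift_space_ext => n; apply/eqP; apply: contra_notT xy => xyn.
by exists n.
Qed.

Lemma shift_dist_sym x y : shift_dist x y = shift_dist y x.
Proof.
rewrite /shift_dist; case: pselect => xy; case: pselect => yx //.
- by congr (_ ^+ _); apply: eq_ex_minn => n; rewrite eq_sym.
- by exfalso; apply: yx; case: xy => n; rewrite eq_sym; exists n.
- by exfalso; apply: xy; case: yx => n; rewrite eq_sym; exists n.
Qed.

Lemma le_shift_dist (x y : Sigma) n : x n != y n -> 2^-1 ^+ n <= shift_dist x y.
Proof.
move=> xyn; rewrite /shift_dist; case: pselect => [xy|nxy]; last first.
  by exfalso; apply: nxy; exists n.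
case: ex_minnP => m _ /(_ _ xyn) mn.
by rewrite ler_wiXn2l // invf_le1 ?ler1n.
Qed.

Lemma shift_dist_triangle y x z :
  shift_dist x z <= shift_dist x y + shift_dist y z.
Proof.
rewrite {1}/shift_dist; case: pselect => [xz|_]; last first.
  by rewrite addr_ge0 ?shift_dist_ge0.
case: ex_minnP => m xzm _; have [xym|xym] := eqVneq (x m) (y m).
  rewrite (le_trans (le_shift_dist (x := y) (y := z) (n := m) _)) -?xym //.
  by rewrite lerDr shift_dist_ge0.
by rewrite (le_trans (le_shift_dist xym)) // lerDl shift_dist_ge0.
Qed.

HB.instance Definition _ := isMetric.Build R Sigma shift_distxx
  shift_dist_positivity shift_dist_sym shift_dist_triangle.

End shift_metric.

(* The chain with its Borel sigma-algebra. *)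
Definition borel_shift (R : realType) (I : countType) (A : markov_matrix I) :=
  g_sigma_algebraType (@open (shift_space R A)).

HB.instance Definition _ (R : realType) (I : countType) (A : markov_matrix I) :=
  Measurable.on (borel_shift R A).

Section shift_dynamics.
Context (R : realType) (I : countType) (A : markov_matrix I).
Local Notation Sigma := (shift_space R A).

Definition left_shift (x : Sigma) : Sigma :=
  ShiftSpace R (fun k => coordinateP x k.+1).

(* The points starting with the word u (possibly none of them). *)
Definition cylinder (u : seq I) : set Sigma :=
  [set z | mkseq z (size u) = u].

(* An n-cylinder prescribes the n + 1 coordinates 0, ..., n. *)
Definition is_ncylinder (n : nat) (F : set Sigma) : Prop :=
  F !=set0 /\ exists2 u : seq I, size u = n.+1 & F = cylinder u.

Definition is_cylinder (F : set Sigma) : Prop := exists n, is_ncylinder n F.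

Definition cylinder_at (n : nat) (w : Sigma) : set Sigma :=
  cylinder (mkseq w n.+1).

Definition topologically_mixing : Prop :=
  forall a b : I, exists N : nat, forall n, (N <= n)%N ->
    exists w : Sigma, w 0%N = a /\ w n = b.

Definition BIP : Prop :=
  exists2 I0 : set I, finite_set I0 &
    forall i, exists k l, [/\ I0 k, I0 l & cylinder [:: k; i; l] !=set0].

Definition cylinder_variation (phi : Sigma -> R) (n : nat) : \bar R :=
  ereal_sup [set e | exists x y : Sigma,
    (forall k, (k < n)%N -> x k = y k) /\ e = `|phi x - phi y|%:E].

Definition weakly_holder (phi : Sigma -> R) : Prop :=
  exists B theta : R, [/\ 0 < B, 0 < theta < 1 &
    forall n, (2 <= n)%N -> (cylinder_variation phi n <= (B * theta ^+ n)%:E)%E].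

Definition birkhoff_sum (phi : Sigma -> R) (n : nat) (x : Sigma) : R :=
  \sum_(0 <= j < n) phi (iter j left_shift x).

Definition periodic_sum (phi : Sigma -> R) (i : I) (n : nat) : \bar R :=
  \esum_(x in [set x : Sigma | x 0%N = i /\ iter n left_shift x = x])
    (expR (birkhoff_sum phi n x))%:E.

(* The common limit, in [-oo, +oo], over all symbols i. *)
Definition gurevich_pressure (phi : Sigma -> R) : \bar R :=
  get [set p : \bar R | forall i : I,
    ((n%:R^-1)%:E * lne (periodic_sum phi i n))%E @[n --> \oo] --> p].

Definition target_set (P : set Sigma) (l : nat -> nat) (w : Sigma) :
    set Sigma :=
  [set z | P z /\ infinite_set
    [set k | cylinder_at (l k) w (iter k left_shift z)]].

Section measure.
Variable mu : probability (borel_shift R A) R.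

Definition gibbs (phi : Sigma -> R) : Prop :=
  exists P c : R, 1 <= c /\
    forall (u : seq I) (z : Sigma), (0 < size u)%N -> cylinder u z ->
      c^-1 <= fine (mu (cylinder u)) /
                expR (- (size u)%:R * P + birkhoff_sum phi (size u) z) <= c.

Definition shift_invariant : Prop :=
  forall B : set (borel_shift R A),
    measurable B -> mu (left_shift @^-1` B) = mu B.

Definition sigma_gibbs (phi : Sigma -> R) : Prop :=
  gibbs phi /\ shift_invariant.

Definition is_atom (B : set (borel_shift R A)) : Prop :=
  [/\ measurable B, (0 < mu B)%E &
    forall B', measurable B' -> B' `<=` B -> mu B' = 0%E \/ mu B' = mu B].

Definition atomless : Prop := forall B, ~ is_atom B.

Definition diam (F : set Sigma) : \bar R :=
  ereal_sup [set e | exists x y, [/\ F x, F y & e = (mdist x y)%:E]].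

(* Covers are at most countable, hence the index set D. *)
Definition cover_inf (alpha eps : R) (E : set Sigma) : \bar R :=
  ereal_inf [set v | exists (D : set nat) (F : nat -> set Sigma),
    [/\ forall i, D i -> is_cylinder (F i) /\ (diam (F i) <= eps%:E)%E,
        E `<=` \bigcup_(i in D) F i &
        v = \esum_(i in D) (fine (mu (F i)) `^ alpha)%:E]].

Definition grid_measure (alpha : R) (E : set Sigma) : \bar R :=
  lim (cover_inf alpha eps E @[eps --> 0^'+]).

Definition grid_dim (E : set Sigma) : \bar R :=
  ereal_inf [set alpha%:E | alpha in
    [set alpha : R | 0 <= alpha /\ grid_measure alpha E = 0%E]].

End measure.

End shift_dynamics.

Arguments topologically_mixing R {I} A.
Arguments BIP R {I} A.

(* Main.v *)
Require Import Defs.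
From HB Require Import structures.
From mathcomp Require Import all_boot all_order all_algebra.
From mathcomp Require Import all_classical all_reals all_analysis.
From mathcomp Require Import ring lra.

Set Implicit Arguments.
Unset Strict Implicit.
Unset Printing Implicit Defensive.

Import Order.TTheory GRing.Theory Num.Theory.
Import numFieldNormedType.Exports.

Local Open Scope classical_set_scope.
Local Open Scope ring_scope.

(* By the Gibbs inequality the measure of a cylinder is quasi-multiplicative
   under concatenation of words, and BIP with mixing joins any two words by a
   word of fixed length K, at the cost of a factor kappa.  Hence
   Z_n(t) = sum_{|u| = n} mu(C_u)^t is exp(n p(t)) up to a constant factor, with
   p(t) = P_G(t phi) - t P_G(phi) convex and strictly decreasing.

   Upper bound: the cylinders of the words u w_0 ... w_{l_k} with |u| = k >= k_0
   cover the target set, and their t-sum is of order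
   sum_{k >= k_0} exp(k (p(t) - s t)).

   Lower bound: if p(t) > s t then some finite set F of words of one length n
   has sum_{u in F} (kappa mu(C_u) exp(-(n + K) s))^t > 1, and this persists for
   slightly larger t.  Given a cover of small t-sum, extend a word step by step,
   choosing in F a continuation that receives at most its share of the cover;
   each step gains a factor, and w_0 ... w_{l_k} is inserted as soon as the gain
   pays for it.  This happens infinitely often, so the limit is a point of the
   target set which the cover misses. *)

(** * Sums over countable index sets and sequences of linear growth *)

(** Sums over words, periodic points and cover elements are compared by coding the indices of one
    sum injectively into those of the other. *)
Lemma le_esum_inj (R : realType) (T T' : choiceType) (D : set T) (D' : set T')
    (f : T -> T') (a : T -> \bar R) (b : T' -> \bar R) :
  (forall x, D x -> D' (f x)) -> set_inj D f -> (forall y, (0 <= b y)%E) ->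
  (forall x, D x -> (a x <= b (f x))%E) ->
  (\esum_(x in D) a x <= \esum_(y in D') b y)%E.
Proof.
move=> fD finj b0 ab; apply: (le_trans (le_esum ab)).
rewrite -(esum_image D f b)// [X in (_ <= X)%E](esumID (f @` D))//.
rewrite -[leLHS]adde0; apply: leeD; last by apply: esum_ge0 => *; exact: b0.
rewrite (_ : _ `&` _ = f @` D)//; apply/seteqP; split => [x []//|y [x Dx <-]].
by split; [exact: fD|exists x].
Qed.

Lemma esum_subset (R : realType) (T : choiceType) (D D' : set T)
    (a : T -> \bar R) :
  D `<=` D' -> (forall y, (0 <= a y)%E) ->
  (\esum_(x in D) a x <= \esum_(x in D') a x)%E.
Proof. by move=> DD a0; apply: (@le_esum_inj _ _ _ _ _ id). Qed.

Lemma ge_esum (R : realType) (T : choiceType) (D : set T) (a : T -> \bar R) x :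
  D x -> (forall y, (0 <= a y)%E) -> (a x <= \esum_(x in D) a x)%E.
Proof.
move=> Dx a0; rewrite -(@esum_set1 R _ x a)//.
by apply: esum_subset => // y ->.
Qed.

Lemma le_esumZl (R : realType) (T : choiceType) (D : set T) (c : R)
    (a : T -> \bar R) : 0 <= c -> (forall y, (0 <= a y)%E) ->
  (\esum_(x in D) (c%:E * a x) <= c%:E * \esum_(x in D) a x)%E.
Proof.
move=> c0 a0; apply: ge_ereal_sup => _ [X [finX XD] <-].
rewrite -ge0_mule_fsumr//; apply: lee_wpmul2l; first by rewrite lee_fin.
by apply: esum_ge; exists X.
Qed.

(** For a positive real [c] the reverse of [le_esumZl] is [le_esumZl] itself with the factor [c^-1].
    For [c = +oo] a single positive term makes both sides infinite. *)
Lemma esumZl (R : realType) (T : choiceType) (D : set T) (c : \bar R)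
    (a : T -> \bar R) : (0 <= c)%E -> (forall y, (0 <= a y)%E) ->
  (\esum_(x in D) (c * a x) = c * \esum_(x in D) a x)%E.
Proof.
move=> + a0; case: c => [c| |//].
- rewrite lee_fin le_eqVlt => /predU1P[<-|c0].
    by rewrite mul0e esum1// => i _; rewrite mul0e.
  apply/eqP; rewrite eq_le le_esumZl ?(ltW c0)//=.
  rewrite muleC. rewrite -lee_pdivlMr// muleC.
  rewrite -[X in (X <= _)%E](_ : \esum_(x in D) ((c^-1)%:E * (c%:E * a x)) =
    _)%E.
    apply: le_esumZl => [|y]; first by rewrite invr_ge0 ltW.
    by rewrite mule_ge0// lee_fin ltW.
  by apply: eq_esum => i _; rewrite muleA -EFinM mulVf ?mul1e ?gt_eqF.
- move=> _; have [a0'|] := pselect (forall x, D x -> a x = 0%E).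
    by rewrite [in RHS]esum1// mule0 esum1// => x /a0' ->; rewrite mule0.
  move=> /existsNP[x /not_implyP[Dx /eqP ax]].
  have ax0 : (0 < a x)%E by rewrite lt_def ax a0.
  rewrite gt0_mulye ?(lt_le_trans ax0) ?ge_esum//.
  apply/eqP; rewrite -leye_eq -[X in (X <= _)%E](gt0_mulye ax0).
  have := @ge_esum R T D (fun x => +oo * a x)%E x Dx; apply=> y.
  by rewrite mule_ge0.
Qed.

Lemma esum_setX (R : realType) (T T' : choiceType) (D : set T) (D' : set T')
    (a : T -> \bar R) (b : T' -> \bar R) :
  (forall x, (0 <= a x)%E) -> (forall y, (0 <= b y)%E) ->
  (\esum_(z in D `*` D') (a z.1 * b z.2) =
   (\esum_(x in D) a x) * (\esum_(y in D') b y))%E.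
Proof.
move=> a0 b0; have b0' : (0 <= \esum_(y in D') b y)%E by exact: esum_ge0.
rewrite [RHS]muleC -esumZl//.
transitivity (\esum_(x in D) \esum_(y in D') (a x * b y))%E.
  by rewrite esum_esum// => x y _ _; rewrite mule_ge0.
by apply: eq_esum => x _; rewrite esumZl// muleC.
Qed.

(** Through this lemma, bounds that hold up to a constant factor at all word lengths become exact
    inequalities between growth exponents. *)
Lemma le_of_linear_growth (R : realType) (a b d : R) :
  (forall n : nat, n%:R * a <= n%:R * b + d) -> a <= b.
Proof.
move=> h; rewrite leNgt; apply/negP => ba.
have dab : 0 <= `|d| / (a - b) by rewrite divr_ge0// subr_ge0 ltW.
have := archi_boundP dab; set n := Num.bound _.
rewrite ltr_pdivrMr ?subr_gt0// => dn.
have := h n; rewrite -lerBlDl -mulrBr => /(lt_le_trans dn).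
by rewrite ltNge ler_norm.
Qed.

(* Comparing [a (n * k)] with both [n%:R * a k] and [k%:R * a n] shows that
   every [(a n - d) / n] is at most every [(a k + d) / k]. *)
Lemma quasi_additive_growth (R : realType) (a : nat -> R) (d : R) :
  (forall n k, (0 < n)%N -> (0 < k)%N -> `|a (n + k)%N - a n - a k| <= d) ->
  exists p, forall n, (0 < n)%N -> `|a n - n%:R * p| <= d.
Proof.
move=> h.
have d0 : 0 <= d by exact: le_trans (h 1 1 _ _)%N.
have mul n k : (0 < n)%N -> (0 < k)%N ->
    `|a (n * k)%N - n%:R * a k| <= n%:R * d.
  move=> + k0; elim: n => // -[_ _|n IH _];
    first by rewrite mul1n !mul1r subrr normr0.
  rewrite mulSn -(natr1 n.+1) !mulrDl !mul1r.
  have := h k (n.+1 * k)%N k0; rewrite muln_gt0/= k0 => /(_ isT).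
  move: (IH isT); rewrite !ler_norml; lra.
have key n k : (0 < n)%N -> (0 < k)%N -> (a n - d) / n%:R <= (a k + d) / k%:R.
  move=> n0 k0; have nR : 0 < n%:R :> R by rewrite ltr0n.
  have kR : 0 < k%:R :> R by rewrite ltr0n.
  rewrite ler_pdivrMr// mulrAC ler_pdivlMr//.
  have := mul n k n0 k0; have := mul k n k0 n0; rewrite mulnC !ler_norml; lra.
(* By [key] every [(a k + d) / k] bounds this set from above, so its supremum serves as the
   slope. *)
pose S := [set (a n - d) / n%:R | n in [set n | (0 < n)%N]].
have S0 : S !=set0 by exists ((a 1%N - d) / 1); exists 1%N.
exists (sup S) => n n0; have nR : 0 < n%:R :> R by rewrite ltr0n.
have h1 : (a n - d) / n%:R <= sup S.
  apply: ub_le_sup; last by exists n.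
  by exists (a 1%N + d) => _ [k k0 <-]; rewrite -[leRHS]divr1;
    exact: (key k 1%N).
have h2 : sup S <= (a n + d) / n%:R.
  by apply: ge_sup => // _ [k k0 <-]; exact: key.
move: h1 h2; rewrite ler_pdivrMr// ler_pdivlMr// ler_norml mulrC; lra.
Qed.

Lemma finite_set_lbound_gt0 (R : realFieldType) (T : choiceType) (D : set T) (f
  : T -> R) :
  finite_set D -> (forall x, D x -> 0 < f x) ->
  exists2 e, 0 < e & forall x, D x -> e <= f x.
Proof.
move=> /finite_seqP[s ->]; elim: s => [|x s IH] fs; first by exists 1.
have [|e e0 es] := IH; first by move=> y ys; apply: fs;
  rewrite /= inE [y \in s]ys orbT.
exists (Num.min e (f x)).
  by rewrite lt_min e0 fs//= inE eqxx.
move=> y /=; rewrite inE => /predU1P[->|ys]; first by rewrite ge_min lexx orbT.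
by rewrite ge_min es.
Qed.

(** * Words and cylinders *)

Section words.
Context (R : realType) (I : countType) (A : markov_matrix I).
Local Notation Sigma := (shift_space R A).
Local Notation cyl := (@cylinder R I A).

Definition admissible (u : seq I) : Prop := cyl u !=set0.

Lemma left_shift_iterE n (x : Sigma) k :
  iter n (@left_shift R I A) x k = x (n + k)%N.
Proof. by elim: n k => // n IH k; rewrite iterS/= IH addnS. Qed.

Lemma mkseqD (T : Type) (f : nat -> T) m n :
  mkseq f (m + n) = mkseq f m ++ mkseq (fun k => f (m + k)%N) n.
Proof. by rewrite /mkseq iotaD map_cat add0n -{2}[m]addn0 iotaDl -map_comp. Qed.

Lemma cylinder_mkseq (z : Sigma) n : cyl (mkseq z n) z.
Proof. by rewrite /cylinder/= size_mkseq. Qed.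

Lemma admissible_mkseq (z : Sigma) n : admissible (mkseq z n).
Proof. by exists z; exact: cylinder_mkseq. Qed.

Lemma cylinder_cat u v z :
  cyl (u ++ v) z <-> cyl u z /\ cyl v (iter (size u) (@left_shift R I A) z).
Proof.
rewrite /cylinder/= size_cat mkseqD.
rewrite (eq_mkseq (left_shift_iterE (size u) z)).
split=> [/eqP|[-> ->]//]; rewrite eqseq_cat ?size_mkseq//.
by move=> /andP[/eqP -> /eqP].
Qed.

Lemma cylinder_nil : cyl [::] = setT.
Proof. by apply/seteqP; split. Qed.

Lemma cylinder_catl u v : cyl (u ++ v) `<=` cyl u.
Proof. by move=> z /cylinder_cat[]. Qed.

Lemma admissible_catl u v : admissible (u ++ v) -> admissible u.
Proof. by move=> [z /cylinder_catl uz]; exists z. Qed.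

Lemma admissible_catr u v : admissible (u ++ v) -> admissible v.
Proof. by move=> [z /cylinder_cat[_ vz]]; eexists; exact: vz. Qed.

Lemma cylinder_disjoint u v : size u = size v -> u != v ->
  cyl u `&` cyl v = set0.
Proof.
move=> uv /eqP nuv; rewrite -subset0 => z [uz vz]; apply: nuv.
by rewrite -uz -vz uv.
Qed.

Lemma cylinder_prefix u v z : cyl u z -> cyl v z -> (size u <= size v)%N ->
  prefix u v.
Proof.
move=> uz vz uv; apply/prefixP;
  exists (mkseq (fun k => z (size u + k)%N) (size v - size u)).
by move: vz; rewrite /cylinder/= -{1}(subnKC uv) mkseqD uz => /esym.
Qed.

Lemma cylinder_glue (x y : Sigma) n : A (x n) (y 0%N) ->
  exists z : Sigma, mkseq z n.+1 = mkseq x n.+1 /\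
    iter n.+1 (@left_shift R I A) z = y.
Proof.
move=> Axy; pose f k := if (k <= n)%N then x k else y (k - n.+1)%N.
have Af k : A (f k) (f k.+1).
  rewrite /f; case: (ltngtP k n) => [kn|kn|->].
  - by rewrite coordinateP.
  - by rewrite subSn ?coordinateP.
  - by rewrite subnn.
exists (ShiftSpace R Af); split.
  apply/eq_in_map => k; rewrite mem_iota add0n => /=.
  by rewrite ltnS /f => ->.
apply: shift_space_ext => k; rewrite left_shift_iterE/= /f.
by rewrite leqNgt ltnS leq_addr/= addKn.
Qed.

Lemma admissible_cat u v a b : A a b -> admissible (rcons u a) ->
  admissible (b :: v) -> admissible (rcons u a ++ b :: v).
Proof.
move=> Aab [x ux] [y vy].
have xa : x (size u) = a.
  have := congr1 (fun s => nth (x 0%N) s (size u)) ux.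
  by rewrite size_rcons nth_mkseq// nth_rcons ltnn eqxx.
have yb : y 0%N = b by case: vy.
have [|z [zx zy]] := @cylinder_glue x y (size u); first by rewrite xa yb.
exists z; apply/cylinder_cat; rewrite /cylinder/= !size_rcons zx zy.
by move: ux; rewrite /cylinder/= size_rcons => ->.
Qed.

(* Words are joined along paths of one fixed length, so that the positions of
   the letters of a concatenation do not depend on the joined words. *)
Lemma connecting_words (hmix : topologically_mixing R A) (hBIP : BIP R A) :
  exists2 K : nat, (0 < K)%N & exists2 X : set (seq I), finite_set X &
    (forall x, X x -> admissible x) /\
    forall u v, u != [::] -> v != [::] -> admissible u -> admissible v ->
      exists x, [/\ X x, size x = K & admissible (u ++ x ++ v)].
Proof.
have [I0 finI0 hI0] := hBIP.
have /choice[N0 hN0] : forall ab : I * I, exists n0, forall n, (n0 <= n)%N ->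
    exists w : Sigma, w 0%N = ab.1 /\ w n = ab.2.
  by move=> [a b]; exact: hmix.
have finII : finite_set (I0 `*` I0) by exact: finite_setX.
have [M hM] : exists M, forall ab, (I0 `*` I0) ab -> (N0 ab <= M)%N.
  have /finite_seqP[s ->] := finII.
  exists (\max_(ab <- s) N0 ab)%N => ab /= abs;
    exact: (@leq_bigmax_seq _ _ xpredT N0).
have /choice[W hW] : forall ab, exists w : Sigma, (I0 `*` I0) ab ->
    w 0%N = ab.1 /\ w M = ab.2.
  move=> ab; have [abI|abI] := pselect ((I0 `*` I0) ab); last by exists point.
  by have [w hw] := hN0 ab M (hM _ abI); exists w.
exists M.+1 => //; exists ((fun ab => mkseq (W ab) M.+1) @` (I0 `*` I0)).
  exact: finite_image.
split=> [_ [ab _ <-]|u v]; first exact: admissible_mkseq.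
(* BIP supplies a letter [l] that may follow the last letter [a] of [u] and a letter [k] that may
   precede the first letter [b] of [v], both in [I0]. The mixing path from [l] to [k] is the joining
   word. *)
case/lastP: u => // u a; case: v => // b v _ _ ua bv.
have [k' [l [_ Il [y]]]] := hI0 a.
rewrite /cylinder/= => -[_ ya yl].
have Aal : A a l by rewrite -ya -yl; exact: coordinateP.
have [k [l' [Ik _ [y']]]] := hI0 b.
rewrite /cylinder/= => -[yk yb _].
have Akb : A k b by rewrite -yk -yb; exact: coordinateP.
have lk : (I0 `*` I0) (l, k) by [].
have [/= W0 WM] := hW _ lk.
have Ws : mkseq (W (l, k)) M.+1 = rcons (mkseq (W (l, k)) M) k.
  by rewrite -addn1 mkseqD /mkseq/= addn0 WM cats1.
have Wl : exists t, mkseq (W (l, k)) M.+1 = l :: t.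
  by rewrite /mkseq/= W0; eexists.
have xv : admissible (mkseq (W (l, k)) M.+1 ++ b :: v).
  rewrite Ws; apply: admissible_cat => //; rewrite -Ws.
  exact: admissible_mkseq.
exists (mkseq (W (l, k)) M.+1); split; first by exists (l, k).
  by rewrite size_mkseq.
have [t tE] := Wl; rewrite tE cat_cons; apply: admissible_cat => //.
by rewrite -cat_cons -tE.
Qed.

(** The point repeats the letters of [y] modulo the period; the wrap is an allowed transition
    because the letter after [a :: u] is again [a]. *)
Lemma periodic_point (a : I) (u : seq I) : admissible (a :: rcons u a) ->
  exists2 z : Sigma, cyl (a :: u) z & iter (size u).+1 (@left_shift R I A) z =
    z.
Proof.
move=> [y]; rewrite -rcons_cons -cats1 => /cylinder_cat[yu yn'].
set n := (size u).+1.
have yn : y n = a by rewrite -[n]addn0 -left_shift_iterE; case: yn'.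
have ya : y 0%N = a by case: yu.
have Af k : A (y (k %% n)%N) (y (k.+1 %% n)%N).
  have kn : (k %% n < n)%N by rewrite ltn_mod.
  rewrite -addn1 -modnDml addn1; move: kn; rewrite leq_eqVlt => /predU1P[kn|kn].
    by have := coordinateP y (k %% n); rewrite kn modnn ya yn.
  by rewrite (modn_small kn) coordinateP.
exists (ShiftSpace R Af).
  transitivity (mkseq y n) => //; apply/eq_in_map => k;
    rewrite mem_iota => /= kn.
  by rewrite modn_small.
by apply: shift_space_ext => k; rewrite left_shift_iterE/= modnDl.
Qed.

(** The word [U j] has at least [j] letters, so coordinate [k] is settled from stage [k.+1] on, and
    the diagonal of the chosen points lies in all the cylinders. *)
Lemma nested_cylinders (U : nat -> seq I) :
  (forall j, admissible (U j)) -> (forall j, prefix (U j) (U j.+1)) ->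
  (forall j, (size (U j) < size (U j.+1))%N) ->
  exists z : Sigma, forall j, cyl (U j) z.
Proof.
move=> aU pU sU; have /choice[y yU] := aU.
have sizeU j : (j <= size (U j))%N.
  by elim: j => // j IH; exact: leq_ltn_trans (sU j).
have pre i j : (i <= j)%N -> cyl (U j) `<=` cyl (U i).
  move=> /subnK <-; elim: (j - i)%N => //= k IH; rewrite addSn.
  have /prefixP[v ->] := pU (k + i)%N.
  by apply: subset_trans IH; exact: cylinder_catl.
have yE i j k : (i <= j)%N -> (k < i)%N -> y j k = y i k.
  move=> ij ki; have := pre _ _ ij (y j) (yU j); have := yU i.
  rewrite /cylinder/= => <- /(congr1 (fun s => nth (y 0%N 0%N) s k)).
  by rewrite !size_mkseq !nth_mkseq//; exact: leq_trans (sizeU i).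
pose f k := y k.+1 k.
have Af k : A (f k) (f k.+1).
  rewrite /f -(@yE k.+1 k.+2)//; exact: coordinateP.
exists (ShiftSpace R Af) => j.
transitivity (mkseq (y j) (size (U j))); last exact: yU.
apply/eq_in_map => k; rewrite mem_iota => /= kj.
have [jk|jk] := leqP j k.+1; last by rewrite /f -(@yE k.+1 j)// ltnW.
have := pre _ _ jk (y k.+1) (yU _); have := yU j.
rewrite /cylinder/= => <- /(congr1 (fun s => nth (y 0%N 0%N) s k)).
by rewrite !size_mkseq !nth_mkseq.
Qed.

End words.
Arguments admissible R {I} A u.

(** * Gibbs measures on cylinders *)

Section word_measure.
Context (R : realType) (I : countType) (A : markov_matrix I).
Variable mu : probability (borel_shift R A) R.
Local Notation Sigma := (shift_space R A).
Local Notation cyl := (@cylinder R I A).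

Lemma open_cylinder u : open (cyl u).
Proof.
rewrite openE => z uz; apply/nbhs_ballP; exists (2^-1 ^+ size u).
  by rewrite /= exprn_gt0// invr_gt0 ltr0n.
move=> y; rewrite ballEmdist/= => zy; rewrite /cylinder/= -[RHS]uz.
apply/eq_in_map => k; rewrite mem_iota => /= ku; apply/eqP; rewrite eq_sym.
apply: contraTT zy => /le_shift_dist yz; rewrite -leNgt; apply: le_trans yz.
by rewrite ler_wiXn2l ?(ltnW ku)// invf_le1 ?ler1n.
Qed.

Lemma measurable_cylinder u : measurable (cyl u : set (borel_shift R A)).
Proof. by apply: sub_sigma_algebra; exact: open_cylinder. Qed.

Definition word_measure (u : seq I) : R := fine (mu (cyl u)).
Local Notation m := word_measure.

Lemma word_measureE u : mu (cyl u) = (m u)%:E.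
Proof. by rewrite fineK// fin_num_measure//; exact: measurable_cylinder. Qed.

Lemma word_measure_ge0 u : 0 <= m u. Proof. exact: fine_ge0. Qed.

Lemma word_measure_le1 u : m u <= 1.
Proof.
by rewrite -lee_fin -word_measureE probability_le1//;
  exact: measurable_cylinder.
Qed.

Lemma word_measure_nil : m [::] = 1.
Proof. by rewrite /m cylinder_nil probability_setT. Qed.

Lemma le_word_measure u v : cyl u `<=` cyl v -> m u <= m v.
Proof.
move=> uv; rewrite -lee_fin -!word_measureE; apply: le_measure => //;
  by rewrite inE; exact: measurable_cylinder.
Qed.

Lemma word_measure_catl u v : m (u ++ v) <= m u.
Proof. by apply: le_word_measure; exact: cylinder_catl. Qed.

Lemma word_measure_prefix u v : prefix u v -> m v <= m u.
Proof. by move=> /prefixP[w ->]; exact: word_measure_catl. Qed.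

Lemma word_measure_add u v v' : size v = size v' -> v != v' ->
  m (u ++ v) + m (u ++ v') <= m u.
Proof.
move=> vv nvv; rewrite -lee_fin EFinD -!word_measureE -measureU//=;
    [|exact: measurable_cylinder..|].
  apply: le_measure; rewrite ?inE; [|exact: measurable_cylinder|].
    by apply: measurableU; exact: measurable_cylinder.
  by move=> z [] /cylinder_catl.
apply: cylinder_disjoint; first by rewrite !size_cat vv.
by rewrite eqseq_cat// eqxx.
Qed.

Lemma not_admissible_word_measure u : ~ admissible R A u -> m u = 0.
Proof.
move=> nu; rewrite /m (_ : cyl u = set0) ?measure0//.
by rewrite -subset0 => z uz; apply: nu; exists z.
Qed.

Lemma esum_word_measure n : (\esum_(u in [set u | size u = n]) (m u)%:E = 1)%E.
Proof.
(* Countable additivity is indexed by natural numbers, so words are numbered by [pickle]; numbers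
   coding no word get the empty set. *)
pose F k := if unpickle k is Some u then cyl u else set0.
pose D := [set pickle u | u in [set u : seq I | size u = n]].
have DF k : D k -> exists2 u, size u = n & F k = cyl u.
  by move=> [u un <-]; exists u => //; rewrite /F pickleK.
transitivity (mu (\bigcup_(k in D) F k)); last first.
  rewrite (_ : \bigcup_(k in D) F k = setT) ?probability_setT//.
  apply/seteqP; split=> // z _; exists (pickle (mkseq z n)).
    by exists (mkseq z n); rewrite //= size_mkseq.
  by rewrite /F pickleK; exact: cylinder_mkseq.
rewrite measure_bigcup; last 2 first.
- by move=> k /DF[u _ ->]; exact: measurable_cylinder.
- move=> _ _ [u un <-] [v vn <-] [z []].
  rewrite /F !pickleK /cylinder/= => uz vz; congr pickle.
  by rewrite -uz -vz un vn.
rewrite nneseries_esum// set_mem_set esum_image//; last first.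
  by move=> u v _ _; exact: (pcan_inj pickleK).
by apply: eq_esum => u _; rewrite -word_measureE /F pickleK.
Qed.

End word_measure.

Section gibbs.
Context (R : realType) (I : countType) (A : markov_matrix I).
Variables (mu : probability (borel_shift R A) R) (phi : shift_space R A -> R).
Variables (P c : R).
Hypothesis c1 : 1 <= c.
Hypothesis hgibbs : forall (u : seq I) (z : shift_space R A),
  (0 < size u)%N -> cylinder u z ->
  c^-1 <= fine (mu (cylinder u)) /
            expR (- (size u)%:R * P + birkhoff_sum phi (size u) z) <= c.
Local Notation Sigma := (shift_space R A).
Local Notation cyl := (@cylinder R I A).
Local Notation m := (word_measure mu).
Local Notation E n z := (expR (- n%:R * P + birkhoff_sum phi n z)).

Let c0 : 0 < c. Proof. exact: lt_le_trans c1. Qed.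

(** Product form of the Gibbs inequality; it extends to the empty word because [c >= 1]. *)
Lemma gibbs_le u z : cyl u z -> c^-1 * E (size u) z <= m u <= c * E (size u) z.
Proof.
move=> uz; have [u0|] := ltnP 0 (size u).
  by have := hgibbs u0 uz;
    rewrite ler_pdivlMr ?expR_gt0// ler_pdivrMr ?expR_gt0.
rewrite leqn0 size_eq0 => /eqP ->; rewrite word_measure_nil oppr0 mul0r add0r.
by rewrite /birkhoff_sum big_nil expR0 !mulr1 invf_le1// c1.
Qed.

Lemma word_measure_gt0 u : admissible R A u -> 0 < m u.
Proof.
move=> [z /gibbs_le/andP[+ _]]; apply: lt_le_trans.
by rewrite mulr_gt0 ?expR_gt0// invr_gt0.
Qed.

Lemma birkhoff_sumD a b z : birkhoff_sum phi (a + b) z =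
  birkhoff_sum phi a z + birkhoff_sum phi b (iter a (@left_shift R I A) z).
Proof.
rewrite /birkhoff_sum (@big_cat_nat _ _ _ a)//= ?leq_addr//; congr (_ + _).
rewrite -{1}[a]add0n big_addn addKn; apply: eq_bigr => j _.
by rewrite iterD.
Qed.

(** Birkhoff sums add up along the orbit, so the Gibbs weight of [u ++ v] is the product of the
    weights of its parts; three uses of the Gibbs inequality cost [c ^+ 3]. *)
Lemma quasi_bernoulli_le u v : m (u ++ v) <= c ^+ 3 * (m u * m v).
Proof.
have [[z uvz]|/not_admissible_word_measure ->] := pselect (admissible R A (u ++
  v));
  last by rewrite !mulr_ge0 ?exprn_ge0 ?word_measure_ge0 ?(ltW c0).
have [uz vz] := (cylinder_cat u v z).1 uvz.
have /andP[_ h1] := gibbs_le uvz.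
have /andP[h2 _] := gibbs_le uz.
have /andP[h3 _] := gibbs_le vz.
apply: (le_trans h1);
  rewrite size_cat birkhoff_sumD natrD opprD mulrDl addrACA expRD.
move: h2 h3; rewrite !ler_pdivrMl// => h2 h3.
rewrite [leRHS](_ : _ = c * ((c * m u) * (c * m v))); last by ring.
by rewrite ler_pM2l//; apply: ler_pM => //; exact: expR_ge0.
Qed.

Lemma quasi_bernoulli_ge u v : admissible R A (u ++ v) ->
  m u * m v <= c ^+ 3 * m (u ++ v).
Proof.
move=> [z uvz].
have [uz vz] := (cylinder_cat u v z).1 uvz.
have /andP[h1 _] := gibbs_le uvz.
have /andP[_ h2] := gibbs_le uz.
have /andP[_ h3] := gibbs_le vz.
apply: (@le_trans _ _ ((c * E (size u) z) *
  (c * E (size v) (iter (size u) (@left_shift R I A) z)))).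
  by apply: ler_pM => //; exact: word_measure_ge0.
move: h1; rewrite size_cat birkhoff_sumD natrD opprD mulrDl addrACA expRD.
rewrite ler_pdivrMl// => h1; rewrite mulrACA.
rewrite [leRHS](_ : _ = c * c * (c * m (u ++ v))); last by ring.
by rewrite ler_pM2l ?mulr_gt0.
Qed.

End gibbs.

(** * Partition functions and pressure *)

Section partition_function.
Context (R : realType) (I : countType) (A : markov_matrix I).
Variable mu : probability (borel_shift R A) R.
Local Notation Sigma := (shift_space R A).
Local Notation cyl := (@cylinder R I A).
Local Notation m := (word_measure mu).
Local Notation adm := (admissible R A).

Definition connectable (K : nat) (kappa : R) : Prop :=
  forall u v, u != [::] -> v != [::] -> adm u -> adm v ->
    exists x, [/\ size x = K, adm (u ++ x ++ v) &
                  kappa * (m u * m v) <= m (u ++ x ++ v)].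

Definition partition (t : R) (n : nat) : \bar R :=
  \esum_(u in [set u | size u = n]) (m u `^ t)%:E.

(* [p] plays the role of P_G(t phi) - t P_G(phi). *)
Definition has_growth (t p : R) : Prop := exists d, forall n, (0 < n)%N ->
  ((expR (n%:R * p - d))%:E <= partition t n <= (expR (n%:R * p + d))%:E)%E.

Lemma partition_ge0 t n : (0 <= partition t n)%E.
Proof. by apply: esum_ge0 => u _; rewrite lee_fin powR_ge0. Qed.

Lemma partition_admissible t n : t != 0 -> partition t n =
  \esum_(u in [set u | size u = n /\ adm u]) (m u `^ t)%:E.
Proof.
move=> t0; rewrite /partition (esumID [set u | adm u]); last first.
  by move=> u _; rewrite lee_fin powR_ge0.
rewrite [X in (_ + X)%E]esum1 ?adde0//.
by move=> u [_ /not_admissible_word_measure ->]; rewrite powR0.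
Qed.

Lemma partition1 n : partition 1 n = 1%E.
Proof.
rewrite -(esum_word_measure mu n); apply: eq_esum => u _.
by rewrite powRr1// word_measure_ge0.
Qed.

Lemma le_partition t t' n : 0 <= t -> t <= t' -> (partition t' n <= partition t
  n)%E.
Proof.
rewrite le_eqVlt => /predU1P[<-|t0] tt.
  apply: le_esum => u _; rewrite lee_fin powRr0.
  rewrite [leRHS](_ : _ = 1 `^ t'); last by rewrite powR1.
  by apply: ge0_ler_powR; rewrite ?nnegrE ?word_measure_ge0 ?word_measure_le1.
apply: le_esum => u _; rewrite lee_fin.
have := word_measure_ge0 mu u; rewrite le_eqVlt => /predU1P[<-|u0].
  by rewrite !powR0 ?gt_eqF// (lt_le_trans t0).
by apply: ger_powR => //; rewrite u0 word_measure_le1.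
Qed.

Section growth.
Variables (K : nat) (C kappa : R).
Hypotheses (K0 : (0 < K)%N) (C0 : 0 < C) (kappa0 : 0 < kappa).
Hypothesis hC : forall u v, m (u ++ v) <= C * (m u * m v).
Hypothesis m_gt0 : forall u, adm u -> 0 < m u.
Hypothesis hK : connectable K kappa.
Variable t : R.
Hypothesis t0 : 0 < t.
Local Notation Z := (partition t).

Lemma partition_gt0 n : (0 < Z n)%E.
Proof.
pose u := mkseq (point : Sigma) n.
have au : adm u by exact: admissible_mkseq.
apply: (@lt_le_trans _ _ (m u `^ t)%:E);
  first by rewrite lte_fin powR_gt0 ?m_gt0.
apply: (@ge_esum _ _ _ (fun u => (m u `^ t)%:E));
  first by rewrite /= size_mkseq.
by move=> v; rewrite lee_fin powR_ge0.
Qed.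

(** Cutting a word after [n] letters is injective, and [hC] bounds each term. *)
Lemma partition_submul n k : (Z (n + k) <= (C `^ t)%:E * (Z n * Z k))%E.
Proof.
have p0 u : (0 <= (m u `^ t)%:E)%E by rewrite lee_fin powR_ge0.
rewrite -esum_setX// -esumZl ?lee_fin ?powR_ge0//; last first.
  by move=> z; rewrite mule_ge0.
apply: (@le_esum_inj _ _ _ _ _ (fun u => (take n u, drop n u))).
- by move=> u /= unk; rewrite size_takel ?unk ?leq_addr// size_drop unk addKn.
- by move=> u v _ _ [tuv duv];
  rewrite -(cat_take_drop n u) tuv duv cat_take_drop.
- by move=> z; rewrite !mule_ge0// lee_fin powR_ge0.
- move=> u _ /=;
  rewrite -!EFinM lee_fin -!powRM ?mulr_ge0 ?word_measure_ge0 ?(ltW C0)//.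
  apply: ge0_ler_powR; rewrite ?(ltW t0)//.
  + by rewrite nnegrE word_measure_ge0.
  + by rewrite nnegrE ?mulr_ge0 ?word_measure_ge0 ?(ltW C0).
  + by rewrite -{1}(cat_take_drop n u) hC.
Qed.

(** All joining words have length [K], so [u] and [v] can be read off from [u ++ x ++ v] and the
    joining map is injective. *)
Lemma partition_supmul n k : (0 < n)%N -> (0 < k)%N ->
  ((kappa `^ t)%:E * (Z n * Z k) <= Z (n + K + k))%E.
Proof.
move=> n0 k0; have p0 u : (0 <= (m u `^ t)%:E)%E by rewrite lee_fin powR_ge0.
rewrite !(partition_admissible _ (lt0r_neq0 t0)).
rewrite -esum_setX// -esumZl ?lee_fin ?powR_ge0//; last first.
  by move=> z; rewrite mule_ge0.
have /choice[x hx] : forall z : seq I * seq I, exists x,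
    ([set u | size u = n /\ adm u] `*` [set u | size u = k /\ adm u]) z ->
    [/\ size x = K, adm (z.1 ++ x ++ z.2) &
        kappa * (m z.1 * m z.2) <= m (z.1 ++ x ++ z.2)].
  move=> [u v]; have [[/= [un au] [vk av]]|nz] := pselect
    (([set u | size u = n /\ adm u] `*` [set u | size u = k /\ adm u]) (u, v));
    last by exists [::].
  have [||//|//|x ?] := hK (u := u) (v := v); last by exists x.
    by rewrite -size_eq0 un -lt0n.
  by rewrite -size_eq0 vk -lt0n.
apply: (@le_esum_inj _ _ _ _ _ (fun z => z.1 ++ x z ++ z.2)).
- move=> [u v] Dz; have [xK axz _] := hx _ Dz; case: Dz => -[/= un au] [vk av].
  by split=> //; rewrite !size_cat xK un vk addnA.
- move=> [u v] [u' v']; rewrite !inE => Dz Dz' /= /eqP.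
  have [xK _ _] := hx _ Dz; have [xK' _ _] := hx _ Dz'.
  case: Dz Dz' => -[/= un _] [vk _] [[/= un' _] [vk' _]].
  rewrite eqseq_cat ?un// => /andP[/eqP uu].
  by rewrite eqseq_cat ?xK// => /andP[_ /eqP ->]; rewrite uu.
- by move=> y; rewrite lee_fin powR_ge0.
- move=> [u v] Dz; have [xK _ xm] := hx _ Dz.
  move: xm; rewrite /= -!EFinM lee_fin -!powRM ?mulr_ge0 ?word_measure_ge0
    ?(ltW kappa0)//.
  move=> xm; apply: ge0_ler_powR; rewrite ?(ltW t0)//.
  + by rewrite nnegrE ?mulr_ge0 ?word_measure_ge0 ?(ltW kappa0).
  + by rewrite nnegrE ?word_measure_ge0.
Qed.

(** The sum over one-letter words, continued through joining words, is already infinite. Together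
    with [partition_fin_num] this lets [Z 1] decide finiteness at all large lengths. *)
Lemma partition_infty n : Z 1 = +oo%E -> (K.+1 < n)%N -> Z n = +oo%E.
Proof.
move=> Zoo Kn; apply/eqP; rewrite -leye_eq.
have k0 : (0 < n - K.+1)%N by rewrite subn_gt0.
have := partition_supmul (ltn0Sn 0) k0.
rewrite add1n subnKC ?(ltnW Kn)// Zoo gt0_mulye ?partition_gt0//.
by rewrite gt0_muley// lte_fin powR_gt0.
Qed.

Lemma partition_fin_num n : (Z 1 < +oo)%E -> (0 < n)%N -> Z n \is a fin_num.
Proof.
move=> Zoo; elim: n => // -[_ _|n IH _].
  by rewrite ge0_fin_numE ?partition_ge0.
rewrite ge0_fin_numE ?partition_ge0//.
rewrite -addn1; apply: le_lt_trans (partition_submul _ _) _.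
rewrite lte_mul_pinfty ?lee_fin ?powR_ge0//.
rewrite lte_mul_pinfty ?partition_ge0 ?IH//.
Qed.

Lemma growth_ex : (Z 1 < +oo)%E -> exists p, has_growth t p.
Proof.
move=> Zoo; pose z n := fine (Z n); pose a n := ln (z n).
have zE n : (0 < n)%N -> Z n = (z n)%:E.
  by move=> n0; rewrite fineK// partition_fin_num.
have z0 n : (0 < n)%N -> 0 < z n by move=> n0;
  rewrite -lte_fin -zE// partition_gt0.
have up n k : (0 < n)%N -> (0 < k)%N -> a (n + k)%N <= ln (C `^ t) + (a n + a
  k).
  move=> n0 k0; have := partition_submul n k.
  rewrite !zE// ?addn_gt0 ?n0// -!EFinM lee_fin => h.
  rewrite /a -!lnM ?posrE ?mulr_gt0 ?powR_gt0 ?z0//.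
  by rewrite ler_ln ?posrE ?mulr_gt0 ?powR_gt0 ?z0// addn_gt0 n0.
have dn n k : (0 < n)%N -> (0 < k)%N -> ln (kappa `^ t) + (a n + a k) <= a (n +
  K + k)%N.
  move=> n0 k0; have := partition_supmul n0 k0.
  rewrite !zE// ?addn_gt0 ?n0// -!EFinM lee_fin => h.
  rewrite /a -!lnM ?posrE ?mulr_gt0 ?powR_gt0 ?z0//.
  by rewrite ler_ln ?posrE ?mulr_gt0 ?powR_gt0 ?z0// !addn_gt0 n0.
have [n k n0 k0|p hp] := @quasi_additive_growth R a
    (`|ln (C `^ t)| + `|ln (C `^ t)| + `|ln (kappa `^ t)| + `|a K|).
  have nk : (0 < n + k)%N by rewrite addn_gt0 n0.
  (* The gap [K] in the lower estimate is removed by cutting [K] letters off again, [Z (n + k + K)]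
     being at most a constant times [Z (n + k) * Z K]; this is where the term [a K] of the error
     comes from. *)
  have h1 := up n k n0 k0; have h2 := dn n k n0 k0; have h3 := up _ _ nk K0.
  rewrite addnAC in h3.
  have := ler_norm (ln (C `^ t)); have := ler_norm (a K).
  have := normr_ge0 (ln (C `^ t)); have := normr_ge0 (a K).
  have := normr_ge0 (ln (kappa `^ t));
    have := lerNnormlW (lexx (`|ln (kappa `^ t)|)).
  rewrite ler_norml; lra.
move: hp; set d := (_ + _ + _) => hp.
exists p, d => n n0; rewrite zE// !lee_fin -[z n]lnK ?posrE ?z0// !ler_expR.
have := hp n n0; rewrite -/(a n) ler_norml => /andP[? ?].
by apply/andP; split; lra.
Qed.

End growth.
End partition_function.

Lemma cvg_lne_growth (R : realType) (f : nat -> \bar R) (q d : R) (n0 : nat) :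
  (forall n, (n0 <= n)%N ->
    ((expR (n%:R * q - d))%:E <= f n <= (expR (n%:R * q + d))%:E)%E) ->
  ((n%:R^-1)%:E * lne (f n))%E @[n --> \oo] --> q%:E.
Proof.
move=> hf.
have hf' n : (n0 <= n)%N -> exists2 r, f n = r%:E & 0 < r /\ `|ln r - n%:R * q|
  <= d.
  move=> /hf; case: (f n) => [r|/andP[]//|/andP[]//].
  rewrite !lee_fin => /andP[r1 r2];
    have r0 : 0 < r by exact: lt_le_trans (expR_gt0 _) r1.
  exists r => //; split=> //; move: r1 r2.
  by rewrite -[r]lnK ?posrE// !ler_expR lnK ?posrE// ler_norml => ? ?;
    apply/andP; split; lra.
apply: cvg_EFin.
  near=> n; have [|r -> [r0 _]] := hf' n; first by near: n;
    exact: nbhs_infty_ge.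
  by rewrite lne_EFin.
apply/cvgrPdist_le => e e0; near=> n.
have n_gt0 : (0 : R) < n%:R by rewrite ltr0n; near: n; exact: nbhs_infty_gt.
have [|r /= -> [r0 rd]] := hf' n; first by near: n; exact: nbhs_infty_ge.
rewrite lne_EFin// -EFinM/= distrC.
rewrite (_ : _ - _ = n%:R^-1 * (ln r - n%:R * q)); last first.
  by rewrite mulrBr mulKf ?gt_eqF.
rewrite normrM ger0_norm ?invr_ge0 ?(ltW n_gt0)// ler_pdivrMl//.
apply: (le_trans rd); rewrite -ler_pdivrMr//.
by near: n; exact: nbhs_infty_ger.
Unshelve. all: by end_near. Qed.

Section pressure.
Context (R : realType) (I : countType) (A : markov_matrix I).
Variables (mu : probability (borel_shift R A) R) (phi : shift_space R A -> R).
Variables (P c : R) (K : nat) (kappa : R).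
Hypothesis c1 : 1 <= c.
Hypothesis hgibbs : forall (u : seq I) (z : shift_space R A),
  (0 < size u)%N -> cylinder u z ->
  c^-1 <= fine (mu (cylinder u)) /
            expR (- (size u)%:R * P + birkhoff_sum phi (size u) z) <= c.
Hypotheses (K0 : (0 < K)%N) (kappa0 : 0 < kappa).
Hypothesis hK : connectable mu K kappa.
Hypothesis letter : forall a : I, admissible R A [:: a].
Hypothesis inhabited : inhabited I.
Local Notation Sigma := (shift_space R A).
Local Notation cyl := (@cylinder R I A).
Local Notation m := (word_measure mu).
Local Notation adm := (admissible R A).
Local Notation Z := (partition mu).
Local Notation sft := (@left_shift R I A).

Let c0 : 0 < c. Proof. exact: lt_le_trans c1. Qed.

(** Undoing the normalisation by [P] is what adds [t * P] to the growth exponent in the pressure of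
    the scaled potential. *)
Let weight (t : R) (n : nat) (z : Sigma) :
  expR (birkhoff_sum (fun x => (t * phi x)%R) n z) =
  (expR (n%:R * P) * expR (- n%:R * P + birkhoff_sum phi n z)) `^ t.
Proof.
by rewrite -expRD addrA mulNr subrr add0r -expRM /birkhoff_sum -mulr_sumr mulrC.
Qed.

(** A point of period [n] is determined by its first [n] letters. *)
Lemma periodic_sum_le (t : R) (i : I) n : 0 < t -> (0 < n)%N ->
  (periodic_sum (fun x => (t * phi x)%R) i n <=
   ((expR (n%:R * P) * c) `^ t)%:E * Z t n)%E.
Proof.
move=> t0 n_gt0; rewrite -esumZl ?lee_fin ?powR_ge0//; last first.
  by move=> u; rewrite lee_fin powR_ge0.
apply: (@le_esum_inj _ _ _ _ _ (fun x : Sigma => mkseq x n)).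
- by move=> x _ /=; rewrite size_mkseq.
- move=> x y; rewrite !inE => -[_ px] [_ py] xy.
  have per (z : Sigma) k : iter n sft z = z -> z k = z (k %% n)%N.
    move=> pz; rewrite {1}(divn_eq k n); elim: (k %/ n)%N => // q IH.
    by rewrite mulSn -addnA -left_shift_iterE pz.
  apply: shift_space_ext => k; rewrite (per x)// (per y)//.
  have := congr1 (fun s => nth (x 0%N) s (k %% n)) xy.
  by rewrite !nth_mkseq// ltn_mod.
- by move=> u; rewrite -EFinM lee_fin mulr_ge0 ?powR_ge0.
- move=> x _; rewrite weight -EFinM lee_fin -powRM; last 2 first.
    by rewrite mulr_ge0 ?expR_ge0 ?ltW.
    exact: word_measure_ge0.
  apply: ge0_ler_powR; rewrite ?(ltW t0)//.
  + by rewrite nnegrE mulr_ge0 ?expR_ge0.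
  + by rewrite nnegrE !mulr_ge0 ?expR_ge0 ?word_measure_ge0 ?ltW.
  + rewrite -mulrA ler_pM2l ?expR_gt0//.
    have /andP[+ _] := gibbs_le c1 hgibbs (cylinder_mkseq x n).
    by rewrite size_mkseq ler_pdivrMl.
Qed.

(** A word [u] of length [k] closes up to a cycle [i x u y] of length [1 + K + k + K] through [i];
    as [u] sits at a fixed position, distinct words give distinct periodic points. *)
Lemma periodic_sum_ge (i : I) : exists2 b, 0 < b & forall (t : R) k, 0 < t ->
  (0 < k)%N ->
  ((b `^ t)%:E * ((expR ((K.*2 + k).+1%:R * P) `^ t)%:E * Z t k) <=
   periodic_sum (fun x => (t * phi x)%R) i (K.*2 + k).+1)%E.
Proof.
(* Each of the two joins costs a factor [kappa] and a factor [m [:: i]]. *)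
pose b0 := kappa * m [:: i] * (kappa * m [:: i]).
have mi : 0 < m [:: i] by apply: (word_measure_gt0 c1 hgibbs).
have b00 : 0 < b0 by rewrite !mulr_gt0.
exists (c^-1 * b0) => [|t k t0 k0]; first by rewrite mulr_gt0 ?invr_gt0.
have /choice[z hz] : forall u, exists z : Sigma, size u = k -> adm u ->
    [/\ z 0%N = i, iter (K.*2 + k).+1 sft z = z,
        mkseq (fun j => z (K.+1 + j)%N) k = u &
        c^-1 * (b0 * m u) <=
        expR (- (K.*2 + k).+1%:R * P + birkhoff_sum phi (K.*2 + k).+1 z)].
  move=> u; have [[uk au]|nu] := pselect (size u = k /\ adm u); last first.
    by exists point => uk au; exfalso; apply: nu.
  have u0 : u != [::] by rewrite -size_eq0 uk -lt0n.
  have [//|x [xK ax mx]] := hK (u := [:: i]) _ u0 (letter i) au.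
  have [//|//|y [yK ay my]] := hK (u := [:: i] ++ x ++ u) (v := [:: i]) _ _ ax
    (letter i).
  have ay' : adm (i :: rcons (x ++ u ++ y) i).
    by move: ay; rewrite cats1 -!cats1 -!catA.
  have [v vc pv] := periodic_point ay'.
  have sv : (size (x ++ u ++ y)).+1 = (K.*2 + k).+1.
    by rewrite !size_cat xK yK uk -addnn addnAC addnA.
  exists v => _ _; split.
  - by case: vc.
  - by rewrite -sv.
  - have : cyl (([:: i] ++ x) ++ u ++ y) v by rewrite -catA.
    move=> /cylinder_cat[_ /cylinder_catl uv].
    transitivity (mkseq (iter (size ([:: i] ++ x)) sft v) (size u)) => //.
    by rewrite uk; apply/eq_in_map => j _; rewrite left_shift_iterE size_cat xK.
  - have /andP[_ h] := gibbs_le c1 hgibbs vc.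
    rewrite -sv ler_pdivrMl//; apply: le_trans h;
      apply: le_trans (_ : _ <= m (i :: x ++ u ++ y ++ [:: i])) _.
      move: my; rewrite -!catA; apply: le_trans.
      rewrite (_ : b0 * m u = kappa * ((kappa * (m [:: i] * m u)) * m [:: i]));
        last by rewrite /b0; ring.
      by rewrite ler_pM2l// ler_pM2r.
    rewrite (_ : i :: _ = (i :: x ++ u ++ y) ++ [:: i]) ?word_measure_catl//.
    by rewrite /= -!catA.
rewrite (partition_admissible _ _ (lt0r_neq0 t0)) -!esumZl ?lee_fin
  ?powR_ge0//; last 2 first.
- by move=> u; rewrite ?mule_ge0 ?lee_fin ?powR_ge0.
- by move=> u; rewrite ?mule_ge0 ?lee_fin ?powR_ge0.
apply: (@le_esum_inj _ _ _ _ _ z).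
- by move=> u [uk au]; have [] := hz u uk au.
- move=> u v; rewrite !inE => -[uk au] [vk av] zuv.
  have [_ _ <- _] := hz u uk au; have [_ _ <- _] := hz v vk av.
  by rewrite zuv.
- by move=> y; rewrite lee_fin expR_ge0.
- move=> u [uk au]; rewrite weight -!EFinM lee_fin -!powRM ?mulr_ge0 ?expR_ge0
    ?word_measure_ge0 ?invr_ge0 ?(ltW kappa0) ?(ltW c0)//.
  apply: ge0_ler_powR; rewrite ?(ltW t0)//.
  + by rewrite nnegrE !mulr_ge0 ?expR_ge0 ?word_measure_ge0 ?invr_ge0 ?(ltW
    kappa0) ?(ltW c0).
  + by rewrite nnegrE !mulr_ge0 ?expR_ge0.
  + rewrite mulrCA ler_pM2l ?expR_gt0// -mulrA.
    by have [] := hz u uk au.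
Qed.

(** The pressure is a chosen common limit; some symbol exists, so that limit is unique. *)
Lemma gurevich_pressure_cvg (psi : Sigma -> R) (q : \bar R) :
  (forall i, ((n%:R^-1)%:E * lne (periodic_sum psi i n))%E @[n --> \oo] --> q)
    ->
  gurevich_pressure psi = q.
Proof.
move=> h; apply: get_unique => // q' hq'; have [i] := inhabited.
exact: cvg_unique (hq' i) (h i).
Qed.

Lemma gurevich_pressure_growth (t p : R) : 0 < t -> has_growth mu t p ->
  gurevich_pressure (fun x => (t * phi x)%R) = (p + t * P)%:E.
Proof.
move=> t0 [d hd]; apply: gurevich_pressure_cvg => i.
have [b b0 hb] := periodic_sum_ge i.
pose D := `|t * ln c| + `|t * ln b| + `|(K.*2).+1%:R * p| + d.
apply: (@cvg_lne_growth _ _ _ D (K.*2).+2) => n Kn.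
have n0 : (0 < n)%N by exact: leq_trans Kn.
apply/andP; split; last first.
  apply: (le_trans (periodic_sum_le _ t0 n0)).
  have /andP[_ h] := hd n n0.
  apply: (le_trans (lee_wpmul2l _ h)); first by rewrite lee_fin powR_ge0.
  rewrite -EFinM lee_fin -[c in X in X <= _]lnK ?posrE// -expRD -expRM -expRD
    ler_expR.
  have := ler_norm (t * ln c); have := normr_ge0 (t * ln b).
  have := normr_ge0 ((K.*2).+1%:R * p); rewrite /D; lra.
pose k := (n - (K.*2).+1)%N; have k0 : (0 < k)%N by rewrite subn_gt0.
have nE : n = (K.*2 + k).+1 by rewrite -addSn subnKC// ltnW.
have := hb t k t0 k0; rewrite -nE; apply: le_trans.
have /andP[h _] := hd k k0.
apply: (@le_trans _ _ ((b `^ t)%:E * ((expR (n%:R * P) `^ t)%:E * (expR (k%:R *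
  p - d))%:E))%E); last first.
  by rewrite lee_wpmul2l ?lee_fin ?powR_ge0// lee_wpmul2l ?lee_fin ?powR_ge0.
rewrite -!EFinM lee_fin -[b in X in _ <= X]lnK ?posrE// -!expRM -!expRD
  ler_expR.
have -> : k%:R = n%:R - (K.*2).+1%:R :> R by rewrite natrB// ltnW.
have := ler_norm ((K.*2).+1%:R * p); have := normr_ge0 (t * ln c).
have := lerNnormlW (lexx `|t * ln b|); rewrite /D; lra.
Qed.

Lemma gurevich_pressure_infty (t : R) : 0 < t -> Z t 1 = +oo%E ->
  gurevich_pressure (fun x => (t * phi x)%R) = +oo%E.
Proof.
move=> t0 Zoo; apply: gurevich_pressure_cvg => i.
have [b b0 hb] := periodic_sum_ge i.
apply: cvg_near_cst; near=> n.
have n1 : ((K.*2).+1 + K.+1 < n)%N by near: n; exact: nbhs_infty_gt.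
have n0 : (0 : R) < n%:R by rewrite ltr0n; exact: leq_ltn_trans n1.
pose k := (n - (K.*2).+1)%N.
have k1 : (K.+1 < k)%N by rewrite ltn_subRL.
have k0 : (0 < k)%N by exact: ltn_trans k1.
have nE : n = (K.*2 + k).+1.
  by rewrite -addSn subnKC// (leq_trans _ (ltnW n1))// leq_addr.
suff -> : periodic_sum (fun x => (t * phi x)%R) i n = +oo%E.
  by rewrite /= gt0_muley// lte_fin invr_gt0.
apply/eqP; rewrite -leye_eq nE; apply: le_trans (hb t k t0 k0).
rewrite (partition_infty kappa0 (word_measure_gt0 c1 hgibbs) hK t0 Zoo k1).
by rewrite !gt0_muley// ?lte_fin ?powR_gt0 ?expR_gt0.
Unshelve. all: by end_near. Qed.

(** This is the case [t = 1]: the cylinders of each length have total measure 1, so the growth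
    exponent is 0 and only [P] remains. *)
Lemma gurevich_pressure_gibbs : gurevich_pressure phi = P%:E.
Proof.
have := @gurevich_pressure_growth 1 0 ltr01; rewrite add0r mul1r.
rewrite (_ : (fun x => 1 * phi x) = phi); last by apply/funext => x;
  rewrite mul1r.
by apply; exists 0 => n _; rewrite partition1 mulr0 addr0 subr0 expR0 lexx.
Qed.

(** The term [t * P] cancels, which leaves the growth exponent of the partition function; if that
    function is infinite at one letter, so is the pressure. *)
Lemma pressure_gap (t : R) : 0 < t ->
  (exists2 p, has_growth mu t p &
    (gurevich_pressure (fun x => (t * phi x)%R) - gurevich_pressure phi *
      t%:E)%E = p%:E) \/
  Z t 1 = +oo%E /\
  (gurevich_pressure (fun x => (t * phi x)%R) - gurevich_pressure phi * t%:E)%E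
    = +oo%E.
Proof.
move=> t0; rewrite gurevich_pressure_gibbs.
have hC := quasi_bernoulli_le c1 hgibbs.
have m0 := word_measure_gt0 c1 hgibbs.
have [Zoo|] := ltP (Z t 1) +oo%E.
  have [p hp] := growth_ex K0 (exprn_gt0 3 c0) kappa0 hC m0 hK t0 Zoo.
  left; exists p => //; rewrite (gurevich_pressure_growth t0 hp) -EFinM -EFinB.
  by congr EFin; ring.
rewrite leye_eq => /eqP Zoo; right.
by split=> //; rewrite (gurevich_pressure_infty t0 Zoo).
Qed.
End pressure.

(** * Joining constants, strict decrease and convexity of the growth exponent *)

Lemma admissible1 (R : realType) (I : countType) (A : markov_matrix I) (a : I) :
  topologically_mixing R A -> admissible R A [:: a].
Proof.
move=> /(_ a a)[n0 /(_ n0 (leqnn _))[w [wa _]]]; exists w.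
by rewrite /cylinder /mkseq/= wa.
Qed.

(** Young's inequality for the conjugate exponents [r^-1] and [(1 - r)^-1]. *)
Lemma weighted_AMGM (R : realType) (x y r : R) : 0 <= x -> 0 <= y -> 0 < r < 1
  ->
  x `^ r * y `^ (1 - r) <= r * x + (1 - r) * y.
Proof.
move=> x0 y0 /andP[r0 r1]; have r1' : 0 < 1 - r by rewrite subr_gt0.
have := @conjugate_powR R (x `^ r) (y `^ (1 - r)) r^-1 (1 - r)^-1
  (powR_ge0 _ _) (powR_ge0 _ _).
rewrite !invr_gt0 !invrK => /(_ r0 r1'); rewrite addrC subrK => /(_ erefl).
by rewrite -!powRrM !mulfV ?gt_eqF// !powRr1// ![_ * r]mulrC ![_ * (1 -
  r)]mulrC.
Qed.

Section growth_properties.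
Context (R : realType) (I : countType) (A : markov_matrix I).
Variables (mu : probability (borel_shift R A) R).
Local Notation m := (word_measure mu).
Local Notation adm := (admissible R A).
Local Notation Z := (partition mu).
Local Notation cyl := (@cylinder R I A).

(** The joining words form a finite set, so their measures have a positive lower bound [e]; the two
    concatenations cost [c ^+ 3] each. *)
Lemma connectable_ex (phi : shift_space R A -> R) (P c : R) :
  topologically_mixing R A -> BIP R A -> 1 <= c ->
  (forall (u : seq I) (z : shift_space R A), (0 < size u)%N -> cylinder u z ->
    c^-1 <= fine (mu (cylinder u)) /
              expR (- (size u)%:R * P + birkhoff_sum phi (size u) z) <= c) ->
  exists K kappa, [/\ (0 < K)%N, 0 < kappa & connectable mu K kappa].
Proof.
move=> hmix hBIP c1 hgibbs; have c0 : 0 < c by exact: lt_le_trans c1.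
have [K K0 [X finX [aX hX]]] := connecting_words hmix hBIP.
have [e e0 eX] := finite_set_lbound_gt0 finX
  (fun x Xx => word_measure_gt0 c1 hgibbs (aX x Xx)).
exists K, (e / c ^+ 6); split=> //; first by rewrite divr_gt0 ?exprn_gt0.
move=> u v u0 v0 au av; have [x [Xx xK axv]] := hX u v u0 v0 au av.
exists x; split=> //.
have h1 := quasi_bernoulli_ge c1 hgibbs axv.
have h2 := quasi_bernoulli_ge c1 hgibbs (admissible_catr axv).
rewrite mulrAC ler_pdivrMr ?exprn_gt0//.
apply: (@le_trans _ _ (c ^+ 3 * (m u * m (x ++ v)))); last first.
  rewrite [leRHS](_ : _ = c ^+ 3 * (c ^+ 3 * m (u ++ x ++ v))); last by ring.
  by rewrite ler_pM2l// exprn_gt0.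
rewrite [leRHS](_ : _ = m u * (c ^+ 3 * m (x ++ v))); last by ring.
rewrite mulrCA ler_wpM2l ?word_measure_ge0//; apply: le_trans h2.
by rewrite ler_wpM2r ?word_measure_ge0// eX.
Qed.

(** After [u], some word of length [K.+1] ends in a letter other than the last letter of [v]. Its
    cylinder is disjoint from that of [v] and keeps a fixed share [eta] of the mass of [u], which
    [v] must miss. *)
Lemma word_measure_decay (K : nat) (kappa : R) :
  infinite_set [set: I] -> (forall a : I, adm [:: a]) ->
  (forall u, adm u -> 0 < m u) -> 0 < kappa -> connectable mu K kappa ->
  exists2 r, 0 < r < 1 & forall u v, u != [::] -> size v = K.+1 ->
    m (u ++ v) <= r * m u.
Proof.
move=> hI letter m0 k0 hK.
have [b _] := infinite_setN0 hI.
have [b' bb'] : exists b', b' != b.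
  apply: contrapT => nb; apply: hI;
    apply: (@sub_finite_set _ _ [set b]) => // x _.
  by apply/eqP; apply: contra_notT nb => xb; exists x.
pose eta := kappa * Num.min (m [:: b]) (m [:: b']).
have eta0 : 0 < eta by rewrite mulr_gt0// lt_min !m0.
(* The maximum with [2^-1] keeps the ratio positive, so that its logarithm can be used. *)
exists (Num.max (1 - eta) 2^-1).
  rewrite lt_max invr_gt0 ltr0n orbT/= gt_max ltrBlDr ltrDl eta0/=.
  by rewrite invf_lt1 ?ltr1n.
move=> u v u0 vK.
have [auv|/not_admissible_word_measure ->] := pselect (adm (u ++ v));
  last first.
  by rewrite mulr_ge0 ?word_measure_ge0// le_max invr_ge0 ler0n orbT.
have au := admissible_catl auv.
suff [d [vd etad]] : exists d, last b v != d /\ eta <= kappa * m [:: d].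
  have [x [xK ax mx]] := hK u [:: d] u0 isT au (letter d).
  have sv : size v = size (x ++ [:: d]) by rewrite size_cat xK addn1.
  have := @word_measure_add _ _ _ mu u v _ sv.
  rewrite (contraNneq _ vd) => [/(_ isT)|->]; last by rewrite last_cat.
  rewrite -lerBrDr => h; apply: (le_trans h).
  apply: (@le_trans _ _ ((1 - eta) * m u)); last first.
    by rewrite ler_wpM2r ?word_measure_ge0// le_max lexx.
  rewrite mulrBl mul1r lerD2l lerN2; apply: le_trans mx.
  by rewrite mulrCA mulrC ler_wpM2l// word_measure_ge0.
have [vb|vb] := eqVneq (last b v) b; last first.
  by exists b; split=> //; rewrite ler_pM2l// ge_min lexx.
exists b'; split; first by rewrite vb eq_sym.
by rewrite ler_pM2l// ge_min lexx orbT.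
Qed.

(** Words of length [q * K.+1 + 1] have measure at most [r ^+ q], so raising the exponent by
    [t' - t] multiplies every term by at most that power of [r ^+ q]; [theta] is the decay per
    letter. *)
Lemma growth_decreasing (K : nat) (kappa : R) :
  infinite_set [set: I] -> (forall a : I, adm [:: a]) ->
  (forall u, adm u -> 0 < m u) -> 0 < kappa -> connectable mu K kappa ->
  exists2 theta, 0 < theta & forall t t' p p', 0 < t -> t <= t' ->
    has_growth mu t p -> has_growth mu t' p' -> p' <= p - theta * (t' - t).
Proof.
move=> hI letter m0 k0 hK.
have [r /andP[r0 r1] hr] := word_measure_decay hI letter m0 k0 hK.
(* The extra letter is the nonempty word at which the decay starts. *)
have hq q u : size u = (q * K.+1).+1 -> m u <= r ^+ q.
  elim: q u => [|q IH] u uq; first by rewrite expr0 word_measure_le1.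
  have tu : size (take (q * K.+1).+1 u) = (q * K.+1).+1.
    by rewrite size_takel// uq mulSn ltnS leq_addl.
  rewrite -(cat_take_drop (q * K.+1).+1 u) exprS.
  have tu0 : take (q * K.+1).+1 u != [::] by rewrite -size_eq0 tu.
  apply: (le_trans (hr _ _ tu0 _)); last by rewrite ler_pM2l// IH.
  by rewrite size_drop uq subSS mulSn addnK.
exists (- ln r / K.+1%:R); first by rewrite divr_gt0// oppr_gt0 ln_lt0// r0.
move=> t t' p p' t0 tt [d hd] [d' hd'].
have Kp : 0 < K.+1%:R :> R by rewrite ltr0n.
suff : K.+1%:R * p' <= K.+1%:R * p + ln r * (t' - t).
  rewrite -[leRHS](_ : K.+1%:R * (p - - ln r / K.+1%:R * (t' - t)) = _);
    last first.
    by field; rewrite gt_eqF.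
  by rewrite ler_pM2l.
apply: (@le_of_linear_growth _ _ _ (d + d' + p - p')) => q.
have /andP[h1 _] := hd' (q * K.+1).+1 isT.
have /andP[_ h2] := hd (q * K.+1).+1 isT.
have h3 : (Z t' (q * K.+1).+1 <= ((r ^+ q) `^ (t' - t))%:E * Z t (q *
  K.+1).+1)%E.
  rewrite -esumZl ?lee_fin ?powR_ge0//; last by move=> u;
    rewrite lee_fin powR_ge0.
  apply: le_esum => u /= uq; rewrite -EFinM lee_fin.
  rewrite -[X in m u `^ X](subrK t) powRD; last first.
    by rewrite subrK gt_eqF// (lt_le_trans t0).
  rewrite ler_wpM2r ?powR_ge0//; apply: ge0_ler_powR;
    rewrite ?subr_ge0// ?nnegrE.
  - exact: word_measure_ge0.
  - by rewrite exprn_ge0 ?ltW.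
  - exact: hq.
have := le_trans (le_trans h1 h3) (lee_wpmul2l _ h2).
rewrite !lee_fin powR_ge0 => /(_ isT).
rewrite -[r]lnK ?posrE// -expRM_natl -expRM -expRD ler_expR lnK ?posrE//.
rewrite -[in X in X -> _]natr1 natrM.
lra.
Qed.

(** Hoelder's inequality in additive form: once the terms are divided by [expR (n%:R * p)] and
    [expR (n%:R * q)], both sums are bounded, so weighted AM-GM term by term loses only a constant
    factor. *)
Lemma growth_convex (a b p q r x : R) : 0 < a -> 0 < b -> 0 < x < 1 ->
  has_growth mu a p -> has_growth mu b q ->
  has_growth mu (x * a + (1 - x) * b) r -> r <= x * p + (1 - x) * q.
Proof.
move=> a0 b0 x01 [d hd] [e he] [f hf]; have /andP[x0 x1] := x01.
have x1' : 0 < 1 - x by rewrite subr_gt0.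
pose y := x * p + (1 - x) * q.
have key n : (0 < n)%N -> expR (n%:R * r - f) <= expR (n%:R * y) * (x * expR d
  + (1 - x) * expR e).
  move=> n0; have /andP[h1 _] := hf n n0.
  have /andP[_ h2] := hd n n0; have /andP[_ h3] := he n n0.
  rewrite -lee_fin; apply: (le_trans h1).
  have pm t u : (0 <= (m u `^ t)%:E)%E by rewrite lee_fin powR_ge0.
  have nn s : 0 <= expR s by exact: expR_ge0.
  apply: (@le_trans _ _ (\esum_(u in [set u | size u = n])
      ((expR (n%:R * y) * (x * expR (- (n%:R * p))))%:E * (m u `^ a)%:E +
       (expR (n%:R * y) * ((1 - x) * expR (- (n%:R * q))))%:E * (m u `^
         b)%:E))%E).
    apply: le_esum => u _; rewrite -!EFinM -EFinD lee_fin.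
    have := @weighted_AMGM _ (m u `^ a * expR (- (n%:R * p))) (m u `^ b * expR
      (- (n%:R * q))) x.
    rewrite !mulr_ge0 ?powR_ge0// => /(_ isT isT x01).
    rewrite !powRM ?powR_ge0// -!powRrM -!expRM.
    rewrite mulrACA -powRD; last by rewrite gt_eqF// addr_gt0// mulr_gt0.
    rewrite -expRD (_ : - _ * x + _ = - (n%:R * y)); last by rewrite /y; ring.
    rewrite expRN ler_pdivrMr ?expR_gt0// [a * x]mulrC [b * _]mulrC =>
      /le_trans; apply.
    by rewrite le_eqVlt; apply/orP; left; apply/eqP; ring.
  rewrite esumD; last 2 first.
  - by move=> u _; rewrite mule_ge0// lee_fin !mulr_ge0// ltW.
  - by move=> u _; rewrite mule_ge0// lee_fin !mulr_ge0// ltW.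
  rewrite !esumZl ?lee_fin ?mulr_ge0 ?(ltW x0) ?(ltW x1')//.
  apply: (le_trans (leeD (lee_wpmul2l _ h2) (lee_wpmul2l _ h3)));
    [by rewrite lee_fin !mulr_ge0 ?(ltW x0) ?(ltW x1')..|].
  rewrite -!EFinM -EFinD lee_fin !expRD !expRN.
  rewrite le_eqVlt; apply/orP; left; apply/eqP; field.
  by rewrite !gt_eqF ?expR_gt0.
set D := x * expR d + (1 - x) * expR e in key.
have D0 : 0 < D by rewrite addr_gt0 ?mulr_gt0 ?expR_gt0.
apply: (@le_of_linear_growth _ _ _ (`|f| + `|ln D|)) => -[|n].
  by rewrite !mul0r add0r addr_ge0.
have : n.+1%:R * r - f <= n.+1%:R * y + ln D.
  by rewrite -ler_expR [leRHS]expRD lnK ?posrE ?key.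
rewrite -/y; have := ler_norm (ln D); have := ler_norm f; lra.
Qed.

End growth_properties.

(** * Upper bound for the dimension *)

Section hitting.
Context (R : realType) (I : countType) (A : markov_matrix I).
Variables (mu : probability (borel_shift R A) R).
Local Notation Sigma := (shift_space R A).
Local Notation m := (word_measure mu).
Local Notation adm := (admissible R A).
Local Notation Z := (partition mu).
Local Notation cyl := (@cylinder R I A).

Lemma shift_dist_le (x y : Sigma) n : mkseq x n = mkseq y n ->
  shift_dist x y <= 2^-1 ^+ n.
Proof.
move=> xy; rewrite /shift_dist; case: pselect => [e|_]; last first.
  by rewrite exprn_ge0// invr_ge0.
case: ex_minnP => k xyk _; rewrite ler_wiXn2l ?invf_le1 ?ler1n//.
rewrite leqNgt; apply: contra_neqN xyk => kn.
by have := congr1 (fun s => nth (x 0%N) s k) xy; rewrite !nth_mkseq.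
Qed.

Lemma diam_cylinder u : (diam (cyl u) <= (2^-1 ^+ size u)%:E)%E.
Proof.
apply: ge_ereal_sup => _ [x [y [ux uy ->]]]; rewrite lee_fin.
by apply: shift_dist_le; rewrite ux uy.
Qed.

Lemma is_cylinder_cylinder u : (0 < size u)%N -> adm u -> is_cylinder (cyl u).
Proof.
move=> u0 au; exists (size u).-1; split=> //.
by exists u => //; rewrite prednK.
Qed.

Lemma cover_inf_ge0 alpha eps E : (0 <= cover_inf mu alpha eps E)%E.
Proof.
apply: le_ereal_inf_tmp => _ [D [F [_ _ ->]]].
by apply: esum_ge0 => i _; rewrite lee_fin powR_ge0.
Qed.

Lemma grid_dim_le alpha E : 0 <= alpha ->
  (forall eps eta, 0 < eps -> 0 < eta -> (cover_inf mu alpha eps E <=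
    eta%:E)%E) ->
  (grid_dim mu E <= alpha%:E)%E.
Proof.
move=> a0 h; apply: ereal_inf_lbound; exists alpha => //; split=> //.
apply: cvg_lim => //; apply: cvg_near_cst; near=> eps.
apply/eqP; rewrite eq_le cover_inf_ge0 andbT; apply/lee_addgt0Pr => eta eta0.
by rewrite add0e; apply: h.
Unshelve. all: by end_near. Qed.

(** Cylinder measures are at most 1, so covering sums do not drop when the exponent falls below
    [alpha]; hence no smaller exponent has zero grid measure. *)
Lemma grid_dim_ge (alpha : R) E :
  (exists2 c : R, 0 < c & forall eps, (c%:E <= cover_inf mu alpha eps E)%E) ->
  (forall u, adm u -> 0 < m u) ->
  (alpha%:E <= grid_dim mu E)%E.
Proof.
move=> [c c0 hc] m0; apply: le_ereal_inf_tmp => _ [b [b0 gb] <-].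
rewrite lee_fin leNgt; apply/negP => ba; move: gb; apply/eqP.
rewrite gt_eqF// (@lt_le_trans _ _ c%:E) ?lte_fin//.
have cb eps : (c%:E <= cover_inf mu b eps E)%E.
  apply: (le_trans (hc eps)); apply: le_ereal_inf_tmp => _ [D [F [hF EF ->]]].
  apply: ge_ereal_inf; eexists; first by exists D, F; split.
  apply: le_esum => i /hF[[n [F0 [u un Fu]]] _]; rewrite lee_fin.
  have mi : 0 < fine (mu (F i)) by move: F0; rewrite Fu => /m0.
  apply: ger_powR; last exact: ltW.
  by rewrite mi/= Fu word_measure_le1.
rewrite /grid_measure; apply: lime_ge; last by near=> eps.
(* A smaller [eps] allows fewer covers, so the infimum is monotone and its limit at 0 exists. *)
apply: nonincreasing_at_right_is_cvge; near=> x => y z _ _ yz.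
apply: le_ereal_inf => _ [D [F [hF EF ->]]].
exists D, F; split=> // i /hF[? h]; split=> //.
by apply: (le_trans h); rewrite lee_fin.
Unshelve. all: by end_near. Qed.

Lemma geometric_esum_le (B r : R) (k0 : nat) : 0 <= B -> 0 <= r < 1 ->
  (\esum_(k in [set k | (k0 <= k)%N]) (B * r ^+ k)%:E <= (B * r ^+ k0 / (1 -
    r))%:E)%E.
Proof.
move=> B0 /andP[r0 r1]; have r1' : 0 < 1 - r by rewrite subr_gt0.
apply: (@le_trans _ _ (\esum_(j in setT) (B * r ^+ k0 * r ^+ j)%:E)%E).
  apply: (@le_esum_inj _ _ _ _ _ (fun k => (k - k0)%N)) => //.
  - move=> x y; rewrite !inE /= => kx ky /(congr1 (addn k0)).
    by rewrite !subnKC.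
  - by move=> y; rewrite lee_fin !mulr_ge0// exprn_ge0.
  - by move=> k /= kk; rewrite -mulrA -exprD subnKC.
rewrite -nneseries_esumT; last by move=> n;
  rewrite lee_fin !mulr_ge0// exprn_ge0.
apply: lime_le; first by apply: is_cvg_nneseries => n _ _;
  rewrite lee_fin !mulr_ge0// exprn_ge0.
near=> n; rewrite sumEFin lee_fin -mulr_sumr ler_wpM2l ?mulr_ge0 ?exprn_ge0//.
rewrite -[leRHS]mul1r ler_pdivlMr// mulrC big_mkord -opprB mulNr -subrX1 opprB.
by rewrite gerBl exprn_ge0.
Unshelve. all: by end_near. Qed.

Variables (w : Sigma) (l : nat -> nat) (s : R).
Local Notation W k := (mkseq w (l k).+1).
Hypothesis m0 : forall u, adm u -> 0 < m u.
Hypothesis hs : - n%:R^-1 * ln (fine (mu (cylinder_at (l n) w))) @[n --> \oo]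
  --> s.

Lemma hit_measure e : 0 < e -> exists k0, forall k, (k0 <= k)%N ->
  expR (- (k%:R * (s + e))) <= m (W k) <= expR (- (k%:R * (s - e))).
Proof.
move=> e0; have /cvgrPdist_le /(_ e e0) [k0 _ hk0] := hs.
exists k0.+1 => k kk;
  have k1 : (0 : R) < k%:R by rewrite ltr0n (leq_trans _ kk).
have := hk0 k (ltnW kk); rewrite /= -/(m (W k)) => h.
rewrite -[m (W k)]lnK ?posrE ?m0//; last exact: admissible_mkseq.
set x := ln _ in h *; rewrite !ler_expR.
have -> : x = - (k%:R * (- k%:R^-1 * x)) by field; rewrite gt_eqF.
rewrite !lerN2 !ler_pM2l//; move: h; rewrite ler_norml => /andP[? ?].
by apply/andP; split; lra.
Qed.

Lemma grid_dim_target_le (P : set Sigma) (C t p : R) : 0 < C ->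
  (forall u v, m (u ++ v) <= C * (m u * m v)) ->
  0 < t -> has_growth mu t p -> p < s * t ->
  (grid_dim mu (target_set P l w) <= t%:E)%E.
Proof.
move=> C0 hC t0 [d hd] pst; apply: grid_dim_le => [|eps eta eps0 eta0];
  first exact: ltW.
(* Half of the gap: an error [e / t] in the exponent of the target measure becomes [e] after raising
   to the power [t], which leaves [expR (- e) ^+ k] at hitting time [k]. *)
pose e := (s * t - p) / 2.
have e0 : 0 < e by rewrite divr_gt0// subr_gt0.
have [k1 hk1] := hit_measure (divr_gt0 e0 t0).
pose r := expR (- e); pose B := C `^ t * expR d.
have r1 : r < 1 by rewrite expR_lt1 oppr_lt0.
have r0 : 0 < r by exact: expR_gt0.
have B0 : 0 < B by rewrite mulr_gt0 ?powR_gt0 ?expR_gt0.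
have [k0 [kk k00 Bk0 epsk0]] : exists k0, [/\ (k1 <= k0)%N, (0 < k0)%N,
    B * r ^+ k0 / (1 - r) <= eta & 2^-1 ^+ k0 <= eps].
  have cB : `|r| < 1 by rewrite gtr0_norm.
  have c2 : `|2^-1| < 1 :> R by rewrite gtr0_norm ?invr_gt0// invf_lt1 ?ltr1n.
  have /cvgrPdist_le /(_ _ eta0) hB := cvg_geometric (B / (1 - r)) cB.
  have /cvgrPdist_le /(_ _ eps0) h2 := cvg_geometric 1 c2.
  near \oo => k0; exists k0; split.
  - by near: k0; exact: nbhs_infty_ge.
  - by near: k0; exact: nbhs_infty_gt.
  - rewrite mulrAC; apply: le_trans (ler_norm _) _; rewrite -normrN -sub0r.
    by near: k0.
  - apply: le_trans (ler_norm _) _; rewrite -normrN -sub0r -[_ ^+ k0]mul1r.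
    by near: k0.
(* Only words with an admissible continuation are kept, since the elements of a cover have to be
   nonempty cylinders. *)
pose S := [set u : seq I | (k0 <= size u)%N /\ adm (u ++ W (size u))].
pose F j := if unpickle j is Some u then cyl (u ++ W (size u)) else set0.
apply: ge_ereal_inf;
  exists (\esum_(j in pickle @` S) (fine (mu (F j)) `^ t)%:E)%E.
  exists (pickle @` S), F; split=> //.
  - move=> _ [u [ku au] <-]; rewrite /F pickleK; split.
      by apply: is_cylinder_cylinder => //; rewrite size_cat size_mkseq addnS.
    apply: (le_trans (diam_cylinder _)); rewrite lee_fin (le_trans _ epsk0)//.
    by rewrite ler_wiXn2l ?invf_le1 ?ler1n// size_cat (leq_trans ku)// leq_addr.
  - move=> z [_ zinf].
    have [k kk0 zk] : exists2 k, (k0 <= k)%N & cylinder_at (l k) w (iter k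
      (@left_shift R I A) z).
      apply: contrapT => nk; apply: zinf;
        apply: (@sub_finite_set _ _ `I_k0) => //.
      by move=> k /= zk; rewrite ltnNge; apply/negP => kk0; apply: nk; exists k.
    have zu : cyl (mkseq z k ++ W k) z.
      by apply/cylinder_cat; split; [exact: cylinder_mkseq|rewrite size_mkseq].
    exists (pickle (mkseq z k)); last by rewrite /F pickleK size_mkseq.
    by exists (mkseq z k) => //; split; rewrite size_mkseq//; exists z.
rewrite esum_image; last by move=> u v _ _; exact: (pcan_inj pickleK).
pose J k := [set u : seq I | size u = k].
have bn u : (0 <= ((C * (m u * m (W (size u)))) `^ t)%:E)%E by rewrite lee_fin
  powR_ge0.
(* The cover is regrouped by hitting time [k], each group being [Z t k] times a factor for the
   target word. *)
apply: (@le_trans _ _ (\esum_(u in \bigcup_(k in [set k | (k0 <= k)%N]) J k)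
    ((C * (m u * m (W (size u)))) `^ t)%:E)%E).
  apply: (@le_esum_inj _ _ _ _ _ id) => //.
    by move=> u [ku _]; exists (size u).
  move=> u [ku au]; rewrite lee_fin /F pickleK.
  by apply: ge0_ler_powR;
    rewrite ?nnegrE ?mulr_ge0 ?word_measure_ge0 ?(ltW t0) ?(ltW C0)// hC.
rewrite esum_bigcupT//; last by move=> i j _ _ [u [<- <-]].
apply: (@le_trans _ _ (\esum_(k in [set k | (k0 <= k)%N]) (B * r ^+ k)%:E)%E);
  last first.
  apply: (le_trans (geometric_esum_le _ _ _)); rewrite ?(ltW B0)// ?(ltW r0)//.
apply: le_esum => k /= k0k.
have kpos : (0 < k)%N by exact: leq_trans k0k.
rewrite (@eq_esum _ _ _ _ (fun u => ((C * m (W k)) `^ t)%:E * (m u `^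
  t)%:E)%E); last first.
  move=> u <-; rewrite -EFinM -powRM ?mulr_ge0 ?word_measure_ge0 ?(ltW C0)//.
  by rewrite mulrAC mulrA.
rewrite esumZl ?lee_fin ?powR_ge0//; last by move=> u; rewrite lee_fin powR_ge0.
have /andP[_ h] := hd k kpos.
have /andP[_ hW] := hk1 k (leq_trans kk k0k).
apply: (le_trans (lee_wpmul2l _ h)); first by rewrite lee_fin powR_ge0.
rewrite -EFinM lee_fin powRM ?word_measure_ge0 ?(ltW C0)// /B -!mulrA ler_pM2l
  ?powR_gt0//.
apply: (@le_trans _ _ (expR (- (k%:R * (s - e / t))) `^ t * expR (k%:R * p +
  d))).
  rewrite ler_pM2r ?expR_gt0//; apply: ge0_ler_powR => //;
    rewrite ?(ltW t0)// nnegrE.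
    exact: word_measure_ge0.
  exact: expR_ge0.
rewrite -expRM -expRM_natl -!expRD ler_expR le_eqVlt; apply/orP; left;
  apply/eqP.
by rewrite /e; field; rewrite gt_eqF.
Unshelve. all: by end_near. Qed.

End hitting.

(** * Lower bound for the dimension *)

Lemma sum_esum_le (R : realType) (T : choiceType) (T' : eqType) (F : seq T')
    (J : T' -> set T) (S : set T) (a : T -> \bar R) :
  uniq F -> (forall x, (0 <= a x)%E) -> (forall u, u \in F -> J u `<=` S) ->
  (forall u v x, u \in F -> v \in F -> J u x -> J v x -> u = v) ->
  (\sum_(u <- F) \esum_(x in J u) a x <= \esum_(x in S) a x)%E.
Proof.
move=> + a0; elim: F S => [|u F IH] S /=; first by rewrite big_nil esum_ge0.
move=> /andP[uF Funiq] JS Jdisj; rewrite big_cons (esumID (J u) S)//.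
apply: leeD.
  by apply: esum_subset => // x ux; split=> //; apply: JS ux; rewrite inE eqxx.
apply: IH => //.
- move=> v vF x vx; split; first by apply: JS vx; rewrite inE vF orbT.
  move=> ux; move: uF; rewrite (Jdisj u v x) ?vF// inE ?eqxx// vF orbT//.
- by move=> v v' x vF vF'; apply: Jdisj; rewrite inE ?vF ?vF' orbT.
Qed.

Lemma infinite_set_nat_unbounded (S : set nat) :
  (forall k0, exists2 k, (k0 <= k)%N & S k) -> infinite_set S.
Proof.
move=> h /finite_seqP[r Sr].
have [k kr] := h (\max_(i <- r) i).+1; rewrite Sr /= => kr'.
by have := @leq_bigmax_seq _ r xpredT id k kr' isT; rewrite leqNgt kr.
Qed.

Section greedy_branch.
Context (R : realType) (I : countType) (A : markov_matrix I).
Variables (mu : probability (borel_shift R A) R).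
Local Notation Sigma := (shift_space R A).
Local Notation m := (word_measure mu).
Local Notation adm := (admissible R A).
Local Notation cyl := (@cylinder R I A).
Variables (w : Sigma) (l : nat -> nat) (s : R).
Local Notation W k := (mkseq w (l k).+1).
Hypothesis m0 : forall u, adm u -> 0 < m u.
Hypothesis hs : - n%:R^-1 * ln (fine (mu (cylinder_at (l n) w))) @[n --> \oo]
  --> s.
Variables (K : nat) (kappa : R).
Hypotheses (kappa0 : 0 < kappa) (hK : connectable mu K kappa).

Variables (t : R) (n : nat) (F : seq (seq I)).
Hypotheses (s0 : 0 <= s) (t0 : 0 < t) (n0 : (0 < n)%N) (Funiq : uniq F).
Hypothesis hF : forall u, u \in F -> size u = n /\ adm u.
Let lambda := \sum_(u <- F) (kappa * m u) `^ t.
Hypothesis hlambda : expR ((n + K)%:R * s * t) < lambda.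
Variable cF : R.
Hypotheses (cF01 : 0 < cF <= 1)
  (hcF : forall u, u \in F -> cF <= (kappa * m u) `^ t).
Variables (D : set nat) (v : nat -> seq I).

(** The words [v i] code the cover to be escaped; the load of [U] is what the cover spends inside
    the cylinder of [U]. *)
Let load (U : seq I) : \bar R :=
  \esum_(i in D `&` [set i | prefix U (v i)]) (m (v i) `^ t)%:E.

(* A state is a word [U], the mass [nu] which it carries, and a lower bound [g]
   of the ratio of [m U `^ t] to that mass. *)
Let invariant (x : seq I * R * R) : Prop := let: (U, nu, g) := x in
  [/\ U != [::] /\ adm U, 0 < nu, 1 <= g, nu * g <= m U `^ t &
      (load U < (cF * nu)%:E)%E].

(** The target word starts at position [size U + K], behind a joining word; it is inserted once the
    gain stays at least 1 after paying for it. *)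
Let hits (U : seq I) (g : R) : bool :=
  1 <= g * (kappa * m (W (size U + K))) `^ t.

(** The bound [cF * nu] ensures that no cover word ends between [U] and [V]: its weight alone would
    exceed the load of [U]. *)
Let step (x y : seq I * R * R) : Prop :=
  let: (U, nu, g) := x in let: (V, _, g') := y in
  [/\ prefix U V, (size U < size V)%N, cF * nu <= m V `^ t &
      if hits U g then exists2 u, size u = (size U + K)%N & V = u ++ W (size U
        + K)
      else g' = lambda * g /\ size V = (size U + (n + K))%N].

Let lambda1 : 1 < lambda.
Proof.
apply: le_lt_trans hlambda; rewrite -expR0 ler_expR.
by rewrite !mulr_ge0// ltW.
Qed.

Let lambda0 : 0 < lambda. Proof. exact: lt_trans lambda1. Qed.

Let powR_joined U x u : kappa * (m U * m u) <= m (U ++ x ++ u) ->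
  m U `^ t * (kappa * m u) `^ t <= m (U ++ x ++ u) `^ t.
Proof.
move=> h; rewrite -powRM ?mulr_ge0 ?word_measure_ge0 ?(ltW kappa0)//.
apply: ge0_ler_powR;
  rewrite ?nnegrE ?mulr_ge0 ?word_measure_ge0 ?(ltW kappa0) ?(ltW t0)//.
by rewrite mulrCA.
Qed.

Let load_le U V : prefix U V -> (load V <= load U)%E.
Proof.
move=> UV; apply: esum_subset => [i [Di Vi]|i];
  last by rewrite lee_fin powR_ge0.
by split=> //; exact: prefix_trans Vi.
Qed.

(* Among the continuations [U ++ x u ++ u], one receives at most its share
   [(kappa * m u) `^ t / lambda] of the load of [U]. *)
Let step_ex x : invariant x -> exists2 y, invariant y & step x y.
Proof.
case: x => -[U nu] g [[U0 aU] nu0 g1 nug loadU].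
have /andP[cF0 cF1] := cF01.
case hit: (hits U g).
(* The target word is inserted without branching: the mass stays and the gain pays. *)
- have aW : adm (W (size U + K)) by exact: admissible_mkseq.
  have [x [xK ax mx]] := hK (v := W (size U + K)) U0 isT aU aW.
  have pre : prefix U (U ++ x ++ W (size U + K)) by exact: prefix_prefix.
  set V := U ++ _ in pre ax mx *.
  have mV := powR_joined mx.
  have gV : nu * (g * (kappa * m (W (size U + K))) `^ t) <= m V `^ t.
    by rewrite mulrA; apply: le_trans mV; rewrite ler_wpM2r ?powR_ge0.
  exists (V, nu, g * (kappa * m (W (size U + K))) `^ t).
    split=> //; last exact: le_lt_trans (load_le pre) loadU.
    by split=> //; rewrite /V; case: (U) U0.
  split=> //.
  + by rewrite /V !size_cat size_mkseq -[X in (X < _)%N]addn0 ltn_add2l addnS.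
  + apply: le_trans gV; apply: (@le_trans _ _ nu);
    first by rewrite ler_piMl// ltW.
    by rewrite ler_peMr// ltW.
  + by rewrite hit; exists (U ++ x); rewrite /V ?catA// size_cat xK.
- have /choice[x hx] : forall u, exists x, u \in F ->
      [/\ size x = K, adm (U ++ x ++ u) & kappa * (m U * m u) <= m (U ++ x ++
        u)].
    move=> u; have [uF|//] := boolP (u \in F); last by exists [::].
    have [un au] := hF uF.
    have u0 : u != [::] by rewrite -size_eq0 un -lt0n.
    by have [x hx] := hK U0 u0 aU au; exists x.
  have [u uF loadu] : exists2 u, u \in F &
      (load (U ++ x u ++ u) < (cF * (nu * (kappa * m u) `^ t / lambda))%:E)%E.
    apply: contrapT => nu'; move: loadU; apply/negP; rewrite -leNgt.
    apply: (@le_trans _ _ (\sum_(u <- F) load (U ++ x u ++ u))%E).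
      rewrite (_ : cF * nu = \sum_(u <- F) (cF * (nu * (kappa * m u) `^ t /
        lambda))).
        rewrite -sumEFin !big_seq; apply: lee_sum => u uF.
        by rewrite leNgt; apply/negP => lu; apply: nu'; exists u.
      rewrite -mulr_sumr -mulr_suml -mulr_sumr -/lambda mulfK// gt_eqF//.
    apply: sum_esum_le => //.
    - by move=> i; rewrite lee_fin powR_ge0.
    - move=> u uF i [Di ui]; split=> //; apply: prefix_trans ui.
      exact: prefix_prefix.
    - move=> u u' i uF uF' [_ /prefixP[r ui]] [_ /prefixP[r' ui']].
      have [xu _ _] := hx _ uF; have [xu' _ _] := hx _ uF'.
      have [un _] := hF uF; have [un' _] := hF uF'.
      move: ui; rewrite ui' -!catA => /eqP.
      rewrite eqseq_cat// => /andP[_]; rewrite eqseq_cat ?xu ?xu'// => /andP[_].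
      by rewrite eqseq_cat ?un ?un'// => /andP[/eqP].
  have [xK ax mx] := hx _ uF; have [un au] := hF uF.
  have pre : prefix U (U ++ x u ++ u) by exact: prefix_prefix.
  set V := U ++ _ in pre ax mx loadu *.
  have mV := powR_joined mx.
  have pu : 0 < (kappa * m u) `^ t by rewrite powR_gt0// mulr_gt0// m0.
  have gV : nu * g * (kappa * m u) `^ t <= m V `^ t.
    by apply: le_trans mV; rewrite ler_wpM2r ?powR_ge0.
  (* Dividing by [lambda] makes the shares of the continuations sum to 1, and the gain grows by the
     same factor. *)
  exists (V, nu * (kappa * m u) `^ t / lambda, lambda * g).
    split=> //.
    + by split=> //; rewrite /V; case: (U) U0.
    + by rewrite divr_gt0// mulr_gt0.
    + by rewrite mulr_ege1// ltW.
    + rewrite [leLHS](_ : _ = nu * g * (kappa * m u) `^ t)//.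
      by field; rewrite gt_eqF.
  split=> //.
  + by rewrite /V !size_cat un -[X in (X < _)%N]addn0 ltn_add2l addn_gt0 n0
    orbT.
  + apply: le_trans gV; rewrite mulrC -mulrA ler_pM2l//.
    by apply: (le_trans (hcF uF)); rewrite ler_peMl// ltW.
  + by rewrite hit; split=> //;
    rewrite /V !size_cat un xK addnC [(n + K)%N]addnC addnC.
Qed.

(** Iterating [step] from [Q] gives nested words. Hits recur because between hits the gain grows by
    [lambda] per step, faster than the price of the target word; the load bound keeps the limit
    point off the cover. *)
Lemma greedy_branch (Q : seq I) : Q != [::] -> adm Q ->
  (\esum_(i in D) (m (v i) `^ t)%:E < (cF * m Q `^ t)%:E)%E ->
  exists z : Sigma, [/\ cyl Q z,
    infinite_set [set k | cylinder_at (l k) w (iter k (@left_shift R I A) z)] &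
    forall i, D i -> ~ cyl (v i) z].
Proof.
move=> Q0 aQ loadQ; have /andP[cF0 cF1] := cF01.
have mQ : 0 < m Q `^ t by rewrite powR_gt0 ?m0.
have /choice[next hnext] : forall x, exists y, invariant x -> invariant y /\
  step x y.
  move=> x; have [ix|nx] := pselect (invariant x); last by exists x.
  by have [y iy xy] := step_ex ix; exists y.
pose st j := iter j next (Q, m Q `^ t, 1).
have inv j : invariant (st j).
  elim: j => [|j IH]; last by have [] := hnext _ IH.
  rewrite /st /=; split=> //; first by rewrite mulr1.
  apply: le_lt_trans loadQ; apply: esum_subset => [i []//|i].
  by rewrite lee_fin powR_ge0.
have stp j : step (st j) (st j.+1) by have [] := hnext _ (inv j).
pose U j := (st j).1.1; pose nu j := (st j).1.2; pose g j := (st j).2.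
have invU j : [/\ U j != [::] /\ adm (U j), 0 < nu j, 1 <= g j,
    nu j * g j <= m (U j) `^ t & (load (U j) < (cF * nu j)%:E)%E].
  by have := inv j; rewrite /U /nu /g; case: (st j) => -[].
have stepU j : [/\ prefix (U j) (U j.+1), (size (U j) < size (U j.+1))%N,
    cF * nu j <= m (U j.+1) `^ t &
    if hits (U j) (g j)
    then exists2 u, size u = (size (U j) + K)%N & U j.+1 = u ++ W (size (U j) +
      K)
    else g j.+1 = lambda * g j /\ size (U j.+1) = (size (U j) + (n + K))%N].
  have := stp j; rewrite /U /nu /g.
  by case: (st j) => -[? ?] ?; case: (st j.+1) => -[? ?] ?.
have sizeU j : (j <= size (U j))%N.
  by elim: j => // j IH; have [_ h _ _] := stepU j; exact: leq_ltn_trans h.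
have [z zU] : exists z : Sigma, forall j, cyl (U j) z.
  by apply: nested_cylinders => j;
    [have [[]] := invU j|have [] := stepU j|have [] := stepU j].
exists z; split; first exact: (zU 0%N).
- apply: infinite_set_nat_unbounded => k0.
  have [j kj hj] : exists2 j, (k0 <= j)%N & hits (U j) (g j).
    apply: contrapT => nohit.
    have free i : g (k0 + i)%N = lambda ^+ i * g k0 /\
        size (U (k0 + i)%N) = (size (U k0) + i * (n + K))%N.
      elim: i => [|i [IHg IHs]].
        by split; [rewrite addn0 expr0 mul1r|rewrite mul0n !addn0].
      have [_ _ _] := stepU (k0 + i)%N; case: ifPn => [h _|_ [gE sE]].
        by exfalso; apply: nohit; exists (k0 + i)%N => //; exact: leq_addr.
      rewrite addnS gE sE IHg IHs exprS mulrA; split=> //.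
      by rewrite mulSn -addnA [(i * _ + _)%N]addnC.
    (* The net logarithmic gain per step without hit; [e] below is chosen so that the error in the
       price of the target uses up half of it. *)
    pose delta := ln lambda - (n + K)%:R * s * t.
    have delta0 : 0 < delta by rewrite subr_gt0 -ltr_expR lnK ?posrE.
    have nK0 : 0 < (n + K)%:R :> R by rewrite ltr0n addn_gt0 n0.
    pose e := delta / (2 * (n + K)%:R * t).
    have e0 : 0 < e by rewrite divr_gt0// !mulr_gt0.
    have [k1 hk1] := hit_measure m0 hs e0.
    have [_ _ g1 _ _] := invU k0; have g0 : 0 < g k0 by exact: lt_le_trans g1.
    have : delta / 2 <= 0.
      (* The offset [k1] puts the hitting time beyond [k1], where [hk1] applies; the absence of hits
         then bounds [i * (delta / 2)] uniformly in [i]. *)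
      apply: (@le_of_linear_growth _ _ _
        (t * (s + e) * (size (U k0) + K)%:R - t * ln kappa - ln (g k0) - k1%:R
          * (delta / 2))) => i.
      have nh : ~~ hits (U (k0 + (k1 + i))%N) (g (k0 + (k1 + i))%N).
        apply/negP => h; apply: nohit; exists (k0 + (k1 + i))%N => //;
          exact: leq_addr.
      move: nh; rewrite /hits; have [-> ->] := free (k1 + i)%N.
      set k := (_ + K)%N.
      have kk1 : (k1 <= k)%N.
        rewrite /k (leq_trans _ (leq_addr _ _))// (leq_trans _ (leq_addl _
          _))//.
        by rewrite (leq_trans (leq_addr i k1))// leq_pmulr// addn_gt0 n0.
      have /andP[hk _] := hk1 k kk1.
      rewrite -ltNge => nh.
      have : lambda ^+ (k1 + i) * g k0 * (kappa * expR (- (k%:R * (s + e)))) `^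
        t < 1.
        apply: le_lt_trans nh;
          rewrite ler_wpM2l ?mulr_ge0 ?exprn_ge0 ?(ltW g0) ?(ltW lambda0)//.
        apply: ge0_ler_powR;
          rewrite ?nnegrE ?mulr_ge0 ?word_measure_ge0 ?expR_ge0 ?(ltW kappa0)
          ?(ltW t0)//.
        by rewrite ler_pM2l.
      have kE : k%:R = (size (U k0) + K)%:R + (k1%:R + i%:R) * (n + K)%:R :> R.
        by rewrite /k !natrD natrM !natrD; ring.
      rewrite -[lambda]lnK ?posrE// -[g k0]lnK ?posrE// -[kappa]lnK ?posrE//
        -expRM_natl -!expRD -expRM -expRD.
      rewrite expR_lt1 !lnK ?posrE// kE natrD.
      have eE : e * (n + K)%:R * t = delta / 2.
        by rewrite /e; field; rewrite -natrD !gt_eqF.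
      have := congr1 (fun r => (k1%:R + i%:R) * r) eE.
      rewrite /= /delta; set x := (n + K)%:R; lra.
    by apply/negP; rewrite -ltNge divr_gt0.
  have [_ _ _] := stepU j; rewrite hj => -[u uj Uj].
  exists (size (U j) + K)%N;
    first by rewrite (leq_trans kj)// (leq_trans (sizeU j))// leq_addr.
  by have := zU j.+1; rewrite Uj => /cylinder_cat[_]; rewrite uj.
- move=> i Di zi.
  have bi S : S i -> ((m (v i) `^ t)%:E <= \esum_(i in S) (m (v i) `^ t)%:E)%E.
    move=> Si; apply: (@ge_esum _ _ _ (fun i => (m (v i) `^ t)%:E)) => // k.
    by rewrite lee_fin powR_ge0.
  have mono a b : prefix a b -> m b `^ t <= m a `^ t.
    move=> ab; apply: ge0_ler_powR;
      rewrite ?nnegrE ?word_measure_ge0 ?(ltW t0)//.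
    exact: word_measure_prefix.
  have exj : exists j, (size (v i) < size (U j))%N by exists (size (v i)).+1;
    exact: sizeU.
  (* The first stage longer than [v i]: at stage 0 the word [v i] is a prefix of [Q] and outweighs
     the whole cover; later it lies between two consecutive stages and outweighs the load of the
     earlier one. *)
  case: (ex_minnP exj) => -[vQ _|j vj minj].
    have vQ' : prefix (v i) Q by apply: (cylinder_prefix zi (zU 0%N));
      exact: ltnW.
    have := le_lt_trans (bi D Di) loadQ; rewrite lte_fin => /lt_le_trans/(_ _).
    move=> /(_ (m Q `^ t)); rewrite ler_piMl ?(ltW mQ)// => /(_ isT).
    by rewrite ltNge mono.
  have Uv : prefix (U j) (v i).
    apply: (cylinder_prefix (zU j) zi); rewrite leqNgt; apply/negP => /minj.
    by rewrite ltnn.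
  have vU : prefix (v i) (U j.+1) by apply: (cylinder_prefix zi (zU j.+1));
    exact: ltnW.
  have [_ _ _ _ h1] := invU j; have [_ _ h2 _] := stepU j.
  have : (load (U j) < (m (v i) `^ t)%:E)%E.
    by apply: (lt_le_trans h1); rewrite lee_fin (le_trans h2)// mono.
  by rewrite ltNge bi.
Qed.

End greedy_branch.

(** All [x u] are at least some [e > 0], so raising the exponent by [h] costs at most the factor [e]
    to the power [h], which is harmless as long as [h * |ln e| < ln S]. *)
Lemma powR_sum_gt1_open (R : realType) (T : choiceType) (F : seq T) (x : T ->
  R) (t : R) :
  (forall u, u \in F -> 0 < x u) -> 1 < \sum_(u <- F) x u `^ t ->
  exists2 t', t < t' & 1 < \sum_(u <- F) x u `^ t'.
Proof.
move=> x0 S1; set S := \sum_(u <- F) _ in S1.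
have [e e0 ex] := @finite_set_lbound_gt0 R T [set` F] x (finite_seq F) x0.
have S0 : 0 < S by exact: lt_trans S1.
have lnS : 0 < ln S by rewrite ln_gt0.
pose h := ln S / (`|ln e| + 1).
have d0 : 0 < `|ln e| + 1 by rewrite ltr_wpDl.
have h0 : 0 < h by rewrite divr_gt0.
exists (t + h); first by rewrite ltrDl.
apply: (@lt_le_trans _ _ (e `^ h * S)).
  rewrite -[e]lnK ?posrE// -[S]lnK ?posrE// -expRM -expRD expR_gt1 ?lnK
    ?posrE//.
  have : h * (`|ln e| + 1) = ln S by rewrite /h divfK// gt_eqF.
  have := ler_wpM2l (ltW h0) (lerNnormlW (lexx `|ln e|)).
  lra.
rewrite /S mulr_sumr !big_seq; apply: ler_sum => u uF.
have xu := x0 u uF.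
rewrite addrC powRD; last by rewrite (gt_eqF xu) implybT.
rewrite ler_wpM2r ?powR_ge0//; apply: ge0_ler_powR;
  rewrite ?nnegrE ?(ltW h0) ?(ltW e0) ?(ltW xu)//.
exact: ex.
Qed.

(** The strict gain [t < t'] matters later: it excludes a gap above [s * T] at the dimension [T]
    itself. *)
Lemma grid_dim_target_gt (R : realType) (I : countType) (A : markov_matrix I)
    (mu : probability (borel_shift R A) R) (w : shift_space R A) (l : nat ->
      nat)
    (s : R) (K : nat) (kappa : R) (P : set (shift_space R A)) (N : nat) (t p :
      R) :
  (forall u, admissible R A u -> 0 < word_measure mu u) ->
  - n%:R^-1 * ln (fine (mu (cylinder_at (l n) w))) @[n --> \oo] --> s ->
  0 < kappa -> connectable mu K kappa -> 0 <= s -> is_ncylinder N P ->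
  0 < t -> has_growth mu t p -> s * t < p ->
  exists2 t', t < t' & (t'%:E <= grid_dim mu (target_set P l w))%E.
Proof.
set m := word_measure mu => m0 hs k0 hK s0 [P0 [Q QN PQ]] t0 [d hd] stp.
have [n n0 hn] : exists2 n, (0 < n)%N & d + K%:R * s * t - t * ln kappa < n%:R
  * (p - s * t).
  have q0 : 0 < p - s * t by rewrite subr_gt0.
  near \oo => n; exists n; first by near: n; exact: nbhs_infty_gt.
  rewrite -ltr_pdivrMr//; near: n; exact: nbhs_infty_gtr.
have : ((expR ((n + K)%:R * s * t) / kappa `^ t)%:E < partition mu t n)%E.
  have /andP[h _] := hd n n0; apply: lt_le_trans h; rewrite lte_fin.
  rewrite -[kappa]lnK ?posrE// -expRM -expRN -expRD ltr_expR natrD; lra.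
(* A sum above a bound has a finite subsum above it, which yields the finite set [F]. *)
rewrite (partition_admissible _ _ (lt0r_neq0 t0)) => /ereal_sup_gt[_ [X [finX
  XD] <-]].
rewrite fsbig_finite//= sumEFin lte_fin ltr_pdivrMr ?powR_gt0// => hX.
set F : seq (seq I) := finmap.enum_fset (fset_set X) in hX.
have hF u : u \in F -> size u = n /\ admissible R A u.
  by move=> uF; apply: XD; apply/set_mem; rewrite -in_fset_set.
(* The price of the [n + K] letters is folded into each term, so that it scales with the exponent
   when the latter is raised. *)
pose x u := kappa * m u * expR (- ((n + K)%:R * s)).
have x0 u : u \in F -> 0 < x u by move=> /hF[_ /m0 ?];
  rewrite !mulr_gt0// expR_gt0.
have km u : 0 <= kappa * m u by rewrite mulr_ge0 ?(ltW k0) ?word_measure_ge0.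
have xE b : \sum_(u <- F) x u `^ b =
    (\sum_(u <- F) (kappa * m u) `^ b) / expR ((n + K)%:R * s * b).
  rewrite mulr_suml; apply: eq_bigr => u _.
  by rewrite /x [LHS]powRM ?expR_ge0// -expRM mulNr expRN.
have [|t' tt' ht'] := @powR_sum_gt1_open R _ F x t x0.
  rewrite xE ltr_pdivlMr ?expR_gt0// mul1r.
  rewrite (eq_bigr (fun u => kappa `^ t * m u `^ t)); last first.
    by move=> u _; rewrite powRM ?word_measure_ge0 ?ltW.
  by rewrite -mulr_sumr [ltRHS]mulrC.
have t'0 : 0 < t' by exact: lt_trans tt'.
move: ht'; rewrite xE ltr_pdivlMr ?expR_gt0// mul1r => ht'.
exists t' => //.
have kF u : [set` F] u -> 0 < (kappa * m u) `^ t'.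
  by move=> /hF[_ /m0 ?]; rewrite powR_gt0// mulr_gt0.
have [e e0 eF] := finite_set_lbound_gt0 (finite_seq F) kF.
have c01 : 0 < Num.min e 1 <= 1 by rewrite lt_min e0 ltr01 ge_min lexx orbT.
have cF u : u \in F -> Num.min e 1 <= (kappa * m u) `^ t'.
  by move=> uF; rewrite ge_min eF.
have Q0 : Q != [::] by rewrite -size_eq0 QN.
have aQ : admissible R A Q by move: P0; rewrite PQ.
apply: grid_dim_ge => //; exists (Num.min e 1 * m Q `^ t').
  by rewrite mulr_gt0 ?powR_gt0 ?m0//; case/andP: c01.
move=> eps; apply: le_ereal_inf_tmp => _ [D [G [hG EG ->]]].
rewrite leNgt; apply/negP => lt.
have /choice[v hv] : forall i, exists u, D i -> G i = cylinder u.
  move=> i; have [/hG[[k [_ [u _ Gu]]] _]|nDi] := pselect (D i);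
    last by exists [::].
  by exists u.
have [|z [Qz zinf nz]] := @greedy_branch R I A mu w l s m0 hs K kappa k0 hK t'
  n F
    s0 t'0 n0 (finmap.fset_uniq _) hF ht' _ c01 cF D v Q Q0 aQ.
  by apply: le_lt_trans lt; apply: le_esum => i Di; rewrite hv.
have [|i Di] := EG z; first by split=> //; rewrite PQ.
by rewrite hv//; exact: nz.
Unshelve. all: by end_near. Qed.

(** * The dimension formulas *)

Theorem theoremB (R : realType) (I : countType) (A : markov_matrix I)
    (phi : shift_space R A -> R) (mu : probability (borel_shift R A) R)
    (w : shift_space R A) (N : nat) (P : set (shift_space R A))
    (l : nat -> nat) (s t1 : R)
    (hI : infinite_set [set: I])
    (hmix : topologically_mixing R A)
    (hBIP : BIP R A)
    (hvar : (\sum_(1 <= n <oo) cylinder_variation phi n < +oo)%E)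
    (hsup : (ereal_sup [set (phi x)%:E | x in [set: shift_space R A]] < +oo)%E)
    (hmu : sigma_gibbs mu phi)
    (hatom : atomless mu)
    (hP : is_ncylinder N P)
    (hs : - n%:R^-1 * ln (fine (mu (cylinder_at (l n) w))) @[n --> \oo] --> s)
    (ht1 : 0 < t1 <= 1)
    (hpress : ((s * t1)%:E <
        gurevich_pressure (fun x => (t1 * phi x)%R)
          - gurevich_pressure phi * t1%:E < +oo)%E)
    (hent : (\esum_(i in [set: I])
        (- (fine (mu (cylinder [:: i])) `^ t1
            * ln (fine (mu (cylinder [:: i])))))%:E < +oo)%E) :
  [/\ grid_dim mu (target_set P l w) =
        ereal_sup [set t%:E | t in [set t : R | t1 <= t /\
          ((s * t)%:E < gurevich_pressure (fun x => (t * phi x)%R)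
                        - gurevich_pressure phi * t%:E)%E]],
      grid_dim mu (target_set P l w) =
        ereal_inf [set t%:E | t in [set t : R | 0 < t /\
          (gurevich_pressure (fun x => (t * phi x)%R)
             - gurevich_pressure phi * t%:E < (s * t)%:E)%E]] &
      weakly_holder phi ->
        exists2 T : R, grid_dim mu (target_set P l w) = T%:E &
          (gurevich_pressure (fun x => (T * phi x)%R)
             - gurevich_pressure phi * T%:E = (s * T)%:E)%E ].
Proof.
have [[P' [c [c1 hgibbs]]] _] := hmu.
have letter := @admissible1 R I A ^~ hmix.
have inhI : inhabited I by have [b _] := infinite_setN0 hI; exists.
have c3 : 0 < c ^+ 3 by rewrite exprn_gt0// (lt_le_trans _ c1).
have m0 := word_measure_gt0 c1 hgibbs.
have hC := quasi_bernoulli_le c1 hgibbs.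
have [K [kappa [K0 k0 hK]]] := connectable_ex hmix hBIP c1 hgibbs.
have [theta theta0 hdec] := growth_decreasing hI letter m0 k0 hK.
have t10 : 0 < t1 by case/andP: ht1.
have s0 : 0 <= s.
  have <- := cvg_lim (@Rhausdorff R) hs; apply: limr_ge; first by apply/cvg_ex;
    exists s.
  near=> n; rewrite mulNr oppr_ge0 mulr_ge0_le0 ?invr_ge0//.
  by apply: ln_le0; exact: word_measure_le1.
pose G t := (gurevich_pressure (fun x => (t * phi x)%R) - gurevich_pressure phi
  * t%:E)%E.
set dim := grid_dim _ _.
have gap t : 0 < t -> (exists2 p, has_growth mu t p & G t = p%:E) \/
    partition mu t 1 = +oo%E /\ G t = +oo%E.
  exact: (pressure_gap c1 hgibbs K0 k0 hK letter inhI).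
have [p1 gr1 Gt1] : exists2 p, has_growth mu t1 p & G t1 = p%:E.
  have [//|[_ Goo]] := gap t1 t10.
  by move: hpress; rewrite -/(G t1) Goo ltxx andbF.
have stp1 : s * t1 < p1 by move: hpress;
  rewrite -/(G t1) Gt1 lte_fin => /andP[].
(* The one-letter partition function decreases in [t], so finiteness at [t1] carries over to all
   larger exponents. *)
have gapR t : t1 <= t -> exists2 p, has_growth mu t p & G t = p%:E.
  move=> tt; have [|//|[Zoo _]] := gap t; first exact: lt_le_trans tt.
  have [d /(_ 1%N isT) /andP[_]] := gr1.
  move=> /(le_trans (le_partition mu 1 (ltW t10) tt)).
  by rewrite Zoo leye_eq.
have dim_gt t p : 0 < t -> has_growth mu t p -> s * t < p ->
    exists2 t', t < t' & (t'%:E <= dim)%E.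
  by move=> t0 gr stp; exact: (grid_dim_target_gt m0 hs k0 hK s0 hP t0 gr stp).
have dim_le t : 0 < t -> (G t < (s * t)%:E)%E -> (dim <= t%:E)%E.
  move=> t0; have [[p gr ->]|[_ ->]//] := gap t t0.
  by rewrite lte_fin; exact: (grid_dim_target_le m0 hs P c3 hC t0 gr).
set inner := ereal_sup _; set outer := ereal_inf _.
have inner_dim : (inner <= dim)%E.
  apply: ge_ereal_sup => _ [t [tt +] <-]; have [p gr Gp] := gapR t tt.
  rewrite -/(G t) Gp lte_fin => stp.
  have [|t' tt' /(le_trans _)] := dim_gt t p _ gr stp;
    first exact: lt_le_trans tt.
  by apply; rewrite lee_fin ltW.
have dim_outer : (dim <= outer)%E.
  by apply: le_ereal_inf_tmp => _ [t [t0 Gt] <-]; exact: dim_le.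
have t1_inner : (t1%:E <= inner)%E.
  apply: ereal_sup_ubound; exists t1 => //; split=> //.
  by rewrite -/(G t1) Gt1 lte_fin.
have decr t t' p p' : t1 <= t -> t < t' -> has_growth mu t p ->
    has_growth mu t' p' -> p' < p.
  move=> tt tt' gr gr'; have t0 := lt_le_trans t10 tt.
  have := hdec t t' p p' t0 (ltW tt') gr gr'.
  have : 0 < theta * (t' - t) by rewrite mulr_gt0// subr_gt0.
  lra.
(* Two points above the supremum [T] are used: at [T + e / 2] the gap is at most [s] times the
   exponent, and strict decrease makes the inequality strict at [T + e]. *)
have outer_inner : (outer <= inner)%E.
  move: t1_inner; case E : inner => [T| |]; rewrite ?leey//.
  rewrite lee_fin => tT.
  apply/lee_addgt0Pr => e e0.
  have [|p gr Gp] := gapR (T + e / 2); first by lra.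
  have [|p' gr' Gp'] := gapR (T + e); first by lra.
  apply: ereal_inf_lbound; exists (T + e) => //; split; first by lra.
  rewrite -/(G _) Gp' lte_fin.
  have pp' : p' < p by apply: (decr (T + e / 2) (T + e)) => //; lra.
  apply: (lt_le_trans pp'); apply: (@le_trans _ _ (s * (T + e / 2)));
    last first.
    by apply: ler_wpM2l => //; lra.
  rewrite leNgt; apply/negP => stp.
  have : ((T + e / 2)%:E <= inner)%E.
    apply: ereal_sup_ubound; exists (T + e / 2) => //; split; first lra.
    by rewrite -/(G _) Gp lte_fin.
  by rewrite E lee_fin; lra.
have dim_inner : dim = inner.
  by apply/eqP; rewrite eq_le inner_dim (le_trans dim_outer).
split=> //.
  by apply/eqP; rewrite eq_le dim_outer dim_inner.
(* By the linear decrease at rate [theta] the gap at [t2] is at most [- theta], hence below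
   [s * t2]; this makes the dimension finite. *)
move=> _; pose t2 := t1 + (p1 / theta + 1).
have p10 : 0 < p1 by apply: le_lt_trans stp1; rewrite mulr_ge0// ltW.
have x0 : 0 < p1 / theta + 1 by rewrite addr_gt0// divr_gt0.
have dimt2 : (dim <= t2%:E)%E.
  have t12 : t1 <= t2 by rewrite lerDl ltW.
  have [p2 gr2 Gp2] := gapR t2 t12.
  apply: dim_le; first exact: lt_le_trans t12.
  rewrite Gp2 lte_fin; have := hdec t1 t2 p1 p2 t10 t12 gr1 gr2.
  have -> : theta * (t2 - t1) = p1 + theta by rewrite /t2; field;
    rewrite gt_eqF.
  have : 0 <= s * t2 by rewrite mulr_ge0// (le_trans (ltW t10)).
  lra.
(* The strict form of the lower bound puts the dimension strictly above [t1], as the convexity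
   argument requires. *)
have [t' t1t' t'dim] := dim_gt t1 p1 t10 gr1 stp1.
move: t'dim dimt2; case dimE : dim => [T| |]//; rewrite lee_fin => t'T _.
have t1T : t1 < T by exact: lt_le_trans t'T.
have T0 : 0 < T by exact: lt_trans t1T.
have [r gr Gr] := gapR T (ltW t1T).
exists T => //; rewrite -/(G T) Gr; congr EFin; apply/eqP; rewrite eq_le.
(* A gap above [s * T] at [T] would give a dimension larger than [T]. *)
apply/andP; split; rewrite leNgt; apply/negP => rT.
  have [t3 Tt3] := dim_gt T r T0 gr rT.
  by rewrite dimE lee_fin leNgt Tt3.
(* If the gap [r] at [T] were below [s * T], convexity between [t1] and [T] with this weight puts
   the gap at [t3 < T] at least [(s * T - r) / 2] below [s * t3], so the dimension would be at most
   [t3]. *)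
pose x := (s * T - r) / (2 * (p1 - s * t1 + (s * T - r))).
have a0 : 0 < s * T - r by rewrite subr_gt0.
have b0 : 0 < p1 - s * t1 by rewrite subr_gt0.
have x01 : 0 < x < 1.
  have c0 : 0 < 2 * (p1 - s * t1 + (s * T - r)) by rewrite mulr_gt0// addr_gt0.
  apply/andP; split; first exact: divr_gt0.
  by rewrite /x ltr_pdivrMr//; lra.
have xE : x * (p1 - s * t1 + (s * T - r)) = (s * T - r) / 2.
  by rewrite /x; field; rewrite gt_eqF// addr_gt0.
pose t3 := x * t1 + (1 - x) * T.
have t13 : t1 <= t3.
  rewrite -subr_ge0 (_ : _ - _ = (1 - x) * (T - t1)); last by rewrite /t3; ring.
  by rewrite mulr_ge0// subr_ge0 ltW//; case/andP: x01.
have t3T : t3 < T.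
  rewrite -subr_gt0 (_ : _ - _ = x * (T - t1)); last by rewrite /t3; ring.
  by rewrite mulr_gt0// ?subr_gt0//; case/andP: x01.
have [p3 gr3 Gp3] := gapR t3 t13.
have cvx := growth_convex t10 T0 x01 gr1 gr gr3.
have : (dim <= t3%:E)%E.
  apply: dim_le; first exact: lt_le_trans t13.
  by rewrite Gp3 lte_fin /t3; lra.
by rewrite dimE lee_fin leNgt t3T.
Unshelve. all: by end_near. Qed.
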